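(* Let $M$ be a manifold of dimension $n\ge 2$ and let $F=\alpha\,\phi\!\left(b^2,\frac{\beta}{\alpha}\right)$ be a Finsler metric on $M$, where $\alpha$ is a Riemannian metric, $\beta$ is a 1-form, $b^2=\|\beta\|_\alpha^2$ and $\phi=\phi(b^2,s)$ is a positive $C^\infty$ function. Then the spray coefficients $G^i$ of $F$ are related to the spray coefficients $G^i_\alpha$ of $\alpha$ by $$\begin{aligned}G^i={}&G^i_\alpha+\alpha Q s^i{}_0+\left\{\Theta(-2\alpha Q s_0+r_{00}+2\alpha^2Rr)+\alpha\Omega(r_0+s_0)\right\}\frac{y^i}{\alpha}\\&+\left\{\Psi(-2\alpha Qs_0+r_{00}+2\alpha^2Rr)+\alpha\Pi(r_0+s_0)\right\}b^i-\alpha^2R(r^i+s^i),\end{aligned}$$ where $$Q=\frac{\phi_2}{\phi-s\phi_2},\qquad R=\frac{\phi_1}{\phi-s\phi_2},$$ $$\Theta=\frac{(\phi-s\phi_2)\phi_2-s\phi\phi_{22}}{2\phi\big(\phi-s\phi_2+(b^2-s^2)\phi_{22}\big)},\qquad \Psi=\frac{\phi_{22}}{2\big(\phi-s\phi_2+(b^2-s^2)\phi_{22}\big)},$$ $$\Pi=\frac{(\phi-s\phi_2)\phi_{12}-s\phi_1\phi_{22}}{(\phi-s\phi_2)\big(\phi-s\phi_2+(b^2-s^2)\phi_{22}\big)},\qquad \Omega=\frac{2\phi_1}{\phi}-\frac{s\phi+(b^2-s^2)\phi_2}{\phi}\,\Pi,$$ and $\phi$ and its derivatives are evaluated at $(b^2,s)$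 with $s=\frac{\beta}{\alpha}$.
   Context: Here $\alpha=\sqrt{a_{ij}(x)y^iy^j}$, $\beta=b_i(x)y^i$, $(a^{ij})=(a_{ij})^{-1}$, $b^i=a^{ij}b_j$, $b^2=\|\beta\|_\alpha^2=a^{ij}b_ib_j$. The function $\phi$ has variables $b^2$ and $s$ and domain $\{|s|\le b<b_o\}$ for some $0<b_o\le+\infty$, and $\|\beta\|_\alpha<b_o$ on $M$. Subscripts $1$, $2$ on $\phi$ denote partial derivatives with respect to the first variable $b^2$ and the second variable $s$. Let $b_{i|j}$ be the coefficients of the covariant derivative of $\beta$ with respect to $\alpha$ (i.e. $b_{i|j}=\partial b_i/\partial x^j-b_k\Gamma^k{}_{ij}$), and $$r_{ij}=\tfrac12(b_{i|j}+b_{j|i}),\quad s_{ij}=\tfrac12(b_{i|j}-b_{j|i}),\quad r_{00}=r_{ij}y^iy^j,\quad s^i{}_0=a^{ij}s_{jk}y^k,$$ $$r_i=b^jr_{ji},\quad s_i=b^js_{ji},\quad r_0=r_iy^i,\quad s_0=s_iy^i,\quad r^i=a^{ij}r_j,\quad s^i=a^{ij}s_j,\quad r=b^ir_i.$$ A Finsler metric is a continuous function $F:TM\to[0,\infty)$, $C^\infty$ and positive off the zero section, positively homogeneous of degree one in $y$, with $g_{ij}=\frac12[F^2]_{y^iy^j}$ positive definite at all $y\neq 0$. The spray coefficients of a Finsler metric $F$ are $G^i=\frac14g^{il}\left\{[F^2]_{x^ky^l}y^k-[F^2]_{x^l}\right\}$ with $(g^{il})=(g_{il})^{-1}$, and $G^i_\alpha$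 is the same expression for $F=\alpha$. *)

(* Defs.v *)
From HB Require Import structures.
From mathcomp Require Import all_boot all_order all_algebra.
From mathcomp Require Import all_classical all_reals all_analysis.

Set Implicit Arguments.
Unset Strict Implicit.
Unset Printing Implicit Defensive.

Import Order.TTheory GRing.Theory Num.Theory.
Import numFieldNormedType.Exports.

Local Open Scope classical_set_scope.
Local Open Scope ring_scope.

Section Smoothness.
Context {R : realType} {V W : normedModType R}.

(* For open [U] in a finite-dimensional [V] this is the usual class C^k. *)
Fixpoint Ck_on (k : nat) (U : set V) (f : V -> W) : Prop :=
  match k with
  | 0 => forall x, U x -> {for x, continuous f}
  | k'.+1 => (forall x, U x -> differentiable f x) /\
             (forall v, Ck_on k' U (fun x => 'D_v f x))
  end.

Definition smooth_on (U : set V) (f : V -> W) : Prop :=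
  forall k, Ck_on k U f.

End Smoothness.

(* Only the values of [chart_map] on [chart_dom] and those of [chart_inv] on the
   image of [chart_dom] are meaningful. *)
Record chart (R : realType) (n : nat) (M : topologicalType) := Chart {
  chart_dom : set M;
  chart_map :> M -> 'rV[R]_n;
  chart_inv : 'rV[R]_n -> M;
  chart_dom_open : open chart_dom;
  chart_img_open : open (chart_map @` chart_dom);
  chart_mapK : forall p, chart_dom p -> chart_inv (chart_map p) = p;
  chart_map_continuous : {within chart_dom, continuous chart_map};
  chart_inv_continuous :
    {within chart_map @` chart_dom, continuous chart_inv}
}.

Section Charts.
Context {R : realType} {n : nat} {M : topologicalType}.
Implicit Types c : chart R n M.

Definition chart_img c : set 'rV[R]_n := c @` chart_dom c.

Definition transition c c' : 'rV[R]_n -> 'rV[R]_n :=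
  fun x => c' (chart_inv c x).

End Charts.

Record manifold (R : realType) (n : nat) := Manifold {
  manifold_space :> topologicalType;
  manifold_hausdorff : hausdorff_space manifold_space;
  manifold_second_countable : @second_countable manifold_space;
  atlas : set (chart R n manifold_space);
  atlas_cover : forall p, exists2 c, atlas c & chart_dom c p;
  atlas_compatible : forall c c', atlas c -> atlas c' ->
    smooth_on (c @` (chart_dom c `&` chart_dom c')) (transition c c')
}.

Section LocalCoordinates.
Context {R : realType} {n : nat}.
Implicit Types (x y : 'rV[R]_n) (z : 'rV[R]_n * 'rV[R]_n) (i j k l : 'I_n).

Definition ebase i : 'rV[R]_n := delta_mx ord0 i.

Definition pd i (f : 'rV[R]_n -> R) x : R := 'D_(ebase i) f x.

(* Partial derivatives on the tangent bundle of a coordinate domain, whose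
   points are the pairs z = (x, y). *)
Definition pdx i (f : 'rV[R]_n * 'rV[R]_n -> R) z : R := 'D_(ebase i, 0) f z.
Definition pdy i (f : 'rV[R]_n * 'rV[R]_n -> R) z : R := 'D_(0, ebase i) f z.

Definition positive_definite (A : 'M[R]_n) : Prop :=
  forall v : 'rV[R]_n, v != 0 ->
    0 < \sum_(i < n) \sum_(j < n) A i j * v 0 i * v 0 j.

Section Spray.
Variable F : 'rV[R]_n * 'rV[R]_n -> R.

Definition sqF z : R := F z ^+ 2.

Definition fundamental_tensor z : 'M[R]_n :=
  \matrix_(i, j) (2^-1 * pdy j (pdy i sqF) z).

Definition spray z i : R :=
  4^-1 * \sum_(l < n) invmx (fundamental_tensor z) i l *
    (\sum_(k < n) pdy l (pdx k sqF) z * z.2 0 k - pdx l sqF z).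

End Spray.

Section AlphaBeta.
Variables (a : 'rV[R]_n -> 'M[R]_n) (b : 'rV[R]_n -> 'rV[R]_n).

Definition alpha z : R :=
  Num.sqrt (\sum_(i < n) \sum_(j < n) a z.1 i j * z.2 0 i * z.2 0 j).

Definition beta z : R := \sum_(i < n) b z.1 0 i * z.2 0 i.

Definition ainv x : 'M[R]_n := invmx (a x).

Definition bup x i : R := \sum_(j < n) ainv x i j * b x 0 j.

Definition bsq x : R :=
  \sum_(i < n) \sum_(j < n) ainv x i j * b x 0 i * b x 0 j.

(* [christoffel x k i j] has upper index k. *)
Definition christoffel x k i j : R :=
  2^-1 * \sum_(l < n) ainv x k l *
    (pd i (fun w => a w l j) x + pd j (fun w => a w i l) x
     - pd l (fun w => a w i j) x).

Definition bcov x i j : R :=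
  pd j (fun w => b w 0 i) x - \sum_(k < n) b x 0 k * christoffel x k i j.

Definition r_ll x i j : R := 2^-1 * (bcov x i j + bcov x j i).
Definition s_ll x i j : R := 2^-1 * (bcov x i j - bcov x j i).

Definition r_00 z : R := \sum_(i < n) \sum_(j < n) r_ll z.1 i j * z.2 0 i * z.2 0 j.

Definition s_u0 z i : R :=
  \sum_(j < n) \sum_(k < n) ainv z.1 i j * s_ll z.1 j k * z.2 0 k.

Definition r_l x i : R := \sum_(j < n) bup x j * r_ll x j i.
Definition s_l x i : R := \sum_(j < n) bup x j * s_ll x j i.

Definition r_0 z : R := \sum_(i < n) r_l z.1 i * z.2 0 i.
Definition s_0 z : R := \sum_(i < n) s_l z.1 i * z.2 0 i.

Definition r_u x i : R := \sum_(j < n) ainv x i j * r_l x j.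
Definition s_u x i : R := \sum_(j < n) ainv x i j * s_l x j.

Definition r_bb x : R := \sum_(i < n) bup x i * r_l x i.

End AlphaBeta.
End LocalCoordinates.

(* Geometric objects on a manifold are given by their components in the charts
   of the atlas, with the tensorial transformation law under change of charts:
   a tangent vector at the point with coordinates x has components y in the
   chart c and 'D_y (transition c c') x in the chart c'. In particular a function
   on the tangent bundle is a family of functions of (x, y). *)
Section Geometry.
Context {R : realType} {n : nat} (M : manifold R n).

Definition tangent_function
    (F : chart R n M -> 'rV[R]_n * 'rV[R]_n -> R) : Prop :=
  forall c c', atlas c -> atlas c' ->
  forall p, chart_dom c p -> chart_dom c' p ->
  forall y, F c' (c' p, 'D_y (transition c c') (c p)) = F c (c p, y).

Definition riemannian_metric (a : chart R n M -> 'rV[R]_n -> 'M[R]_n) : Prop :=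
  (forall c, atlas c ->
    smooth_on (chart_img c) (a c) /\
    forall x, chart_img c x -> (a c x)^T = a c x /\ positive_definite (a c x)) /\
  (forall c c', atlas c -> atlas c' ->
   forall p, chart_dom c p -> chart_dom c' p ->
   forall u v : 'rV[R]_n,
   let u' := 'D_u (transition c c') (c p) in
   let v' := 'D_v (transition c c') (c p) in
   \sum_(i < n) \sum_(j < n) a c' (c' p) i j * u' 0 i * v' 0 j =
   \sum_(i < n) \sum_(j < n) a c (c p) i j * u 0 i * v 0 j).

Definition one_form (b : chart R n M -> 'rV[R]_n -> 'rV[R]_n) : Prop :=
  (forall c, atlas c -> smooth_on (chart_img c) (b c)) /\
  tangent_function (fun c => beta (b c)).

Definition finsler_metric
    (F : chart R n M -> 'rV[R]_n * 'rV[R]_n -> R) : Prop :=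
  tangent_function F /\
  forall c, atlas c ->
  [/\ forall x y, chart_img c x -> 0 <= F c (x, y),
      forall x y, chart_img c x -> {for (x, y), continuous (F c)},
      smooth_on [set z | chart_img c z.1 /\ z.2 != 0] (F c),
      forall x y, chart_img c x -> y != 0 -> 0 < F c (x, y) &
      (forall x y (t : R), chart_img c x -> 0 < t ->
         F c (x, t *: y) = t * F c (x, y)) /\
      (forall x y, chart_img c x -> y != 0 ->
         positive_definite (fundamental_tensor (F c) (x, y)))].

End Geometry.

Section Phi.
Context {R : realType}.
Implicit Types (p : R * R).

(* A pair p = (p.1, p.2) stands for (b^2, s). *)
Definition phi_domain (bo : \bar R) : set (R * R) :=
  [set p | exists b : R, [/\ p.1 = b ^+ 2, `|p.2| <= b & (b%:E < bo)%E]].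

Variable phi : R * R -> R.

Definition d1 (f : R * R -> R) p : R := 'D_((1, 0) : R * R) f p.
Definition d2 (f : R * R -> R) p : R := 'D_((0, 1) : R * R) f p.

Let phi1 := d1 phi.
Let phi2 := d2 phi.
Let phi12 := d2 (d1 phi).
Let phi22 := d2 (d2 phi).

Definition phiQ p : R := phi2 p / (phi p - p.2 * phi2 p).

Definition phiR p : R := phi1 p / (phi p - p.2 * phi2 p).

Definition phiDelta p : R :=
  phi p - p.2 * phi2 p + (p.1 - p.2 ^+ 2) * phi22 p.

Definition phiTheta p : R :=
  ((phi p - p.2 * phi2 p) * phi2 p - p.2 * phi p * phi22 p) /
  (2 * phi p * phiDelta p).

Definition phiPsi p : R := phi22 p / (2 * phiDelta p).

Definition phiPi p : R :=
  ((phi p - p.2 * phi2 p) * phi12 p - p.2 * phi1 p * phi22 p) /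
  ((phi p - p.2 * phi2 p) * phiDelta p).

Definition phiOmega p : R :=
  2 * phi1 p / phi p
  - (p.2 * phi p + (p.1 - p.2 ^+ 2) * phi2 p) / phi p * phiPi p.

End Phi.

(* Main.v *)
Require Import Defs.
From HB Require Import structures.
From mathcomp Require Import all_boot all_order all_algebra.
From mathcomp Require Import all_classical all_reals all_analysis.
From mathcomp Require Import ring lra.

Import Order.TTheory GRing.Theory Num.Theory.
Import numFieldNormedType.Exports.

Local Open Scope classical_set_scope.
Local Open Scope ring_scope.

(** The spray coefficients of [F] are the unique solution [V] of the linear system
    [4 g_(lm) V^m = (F^2)_(x^k y^l) y^k - (F^2)_(x^l)], because the fundamental
    tensor [g] is invertible. Hence no inverse of [g] has to be computed: it is
    enough to check that the asserted right-hand side solves this system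
    ([spray_alphabeta]).

    Both sides are computed by regarding [F^2] as a function of the three
    quantities [alpha^2], [beta] and [b^2] ([is_derive_energy]). As [b^2] does not
    depend on [y], second derivatives in which the last one is taken along the
    fibre involve only [phi], [phi_1], [phi_2], [phi_12] and [phi_22].
    - The left-hand side: [g_(lm)] is a combination of [a_(lm)], [y_l] and [b_l]
      ([lower_fundamental]), so contracting it with [V] requires only [a_(lm) V^m]
      and the scalar products of [V] with [y] and with [b].
    - The right-hand side ([spray_rhsE]): the derivatives of [alpha^2] give the
      spray of [alpha]; those of [beta] give in addition [r_00] and [s_(l0)], which
      are what the Christoffel symbols leave of them; and those of [b^2] are
      [2 (r_k + s_k)] since the connection of [alpha] is metric ([derive_bsq]).
    What remains is a rational identity ([contracted_spray_equation]).

    That identity divides by [phi - s phi_2] and by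
    [Delta = phi - s phi_2 + (b^2 - s^2) phi_22]. Both are positive because [g] is
    positive definite. For the first, let [w] be annihilated by [beta]. The
    restriction of [F^2] to the line [u + h w] through a multiple [u] of the vector
    dual to [beta] is strictly convex, and its derivative is
    [2 phi (phi - s phi_2) a(w, w) h]; this vanishes at [h = 0], so that it is positive at
    [h = 1]. If [y] itself is a multiple of the vector dual to [beta], the second
    derivative in a direction annihilated by [beta] is used instead, and such a
    direction exists as the dimension is at least two ([energy_alpha_gt0]). For
    [Delta], the tensor [g] is evaluated on the component of the dual vector that
    is [g]-orthogonal to [y] ([phiDelta_gt0]). *)

(** * Directional derivatives *)

Section DirectionalDerivatives.
Set Implicit Arguments.
Unset Strict Implicit.
Context {R : realType} {V : normedModType R}.
Implicit Types (f g : V -> R) (x v : V).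

(** Restricting to the line through [x] reduces the calculus of directional
    derivatives to that of functions of one real variable. *)
Lemma is_derive_lineP (U W : normedModType R) (f : U -> W) (x v : U) df :
  is_derive x v f df <-> is_derive (0 : R) 1 (fun h : R => f (h *: v + x)) df.
Proof.
have E : 'D_v f x = 'D_1 (fun h : R => f (h *: v + x)) 0.
  rewrite /derive; set g1 := fun h => h^-1 *: _; set g2 := fun h => h^-1 *: _.
  suff -> : g1 = g2 by [].
  by apply/funext => h; rewrite /g1 /g2 /= addr0 scale0r add0r [_%:A]mulr1.
split=> -[fx <-].
  by apply: DeriveDef; [exact: (derivable1P f x v).1 | rewrite E].
by apply: DeriveDef; [exact: (derivable1P f x v).2 | rewrite E].
Qed.

Lemma is_derive_along f x v (t df : R) :
  is_derive (x + t *: v) v f df -> is_derive t 1 (fun h : R => f (x + h *: v)) df.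
Proof.
move=> /is_derive_lineP H; apply/is_derive_lineP.
apply: is_derive_eq.
  have -> : (fun h : R => f (x + (h *: (1:R) + t) *: v)) =
            (fun h : R => f (h *: v + (x + t *: v))).
    apply/funext => h; congr f.
    by rewrite [h *: 1]mulr1 scalerDl addrCA.
  exact: H.
by [].
Qed.

(** For the inner functions a derivative in the direction [v] is enough: the outer
    function is composed with a path in the plane, and a path that is derivable at
    a point is differentiable there. *)
Lemma is_derive_comp2 (h : R * R -> R) f g x v (df dg : R) :
  differentiable h (f x, g x) -> is_derive x v f df -> is_derive x v g dg ->
  is_derive x v (fun z => h (f z, g z))
    (d1 h (f x, g x) * df + d2 h (f x, g x) * dg).
Proof.
move=> dh /is_derive_lineP[f1 f2] /is_derive_lineP[g1 g2]; apply/is_derive_lineP.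
set F := (fun k : R => f _) in f1 f2; set G := (fun k : R => g _) in g1 g2.
have F0 : F 0 = f x by rewrite /F scale0r add0r.
have G0 : G 0 = g x by rewrite /G scale0r add0r.
have dF : differentiable F 0 by apply/derivable1_diffP.
have dG : differentiable G 0 by apply/derivable1_diffP.
have dFG : differentiable (fun k => (F k, G k)) (0 : R).
  exact: differentiable_pair.
have dh' : differentiable h (F 0, G 0) by rewrite F0 G0.
have dhc : differentiable (h \o (fun k => (F k, G k))) (0 : R).
  exact: differentiable_comp.
apply: DeriveDef; first by apply/derivable1_diffP.
rewrite [LHS](deriveE _ dhc) diff_comp//= diff_pair//=.
rewrite -!deriveE// F0 G0 f2 g2.
have -> : (df, dg) = df *: ((1, 0) : R * R) + dg *: ((0, 1) : R * R).
  have e1 : df = df * 1 + dg * 0 by ring.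
  have e2 : dg = df * 0 + dg * 1 by ring.
  exact: (congr2 pair e1 e2).
rewrite deriveE// linearD !linearZ /d1 /d2 !deriveE//=.
by rewrite ![_ *: _]mulrC.
Qed.

Lemma is_derive_bigsum n (f : 'I_n -> V -> R) x v (df : 'I_n -> R) :
  (forall i, is_derive x v (f i) (df i)) ->
  is_derive x v (fun z => \sum_(i < n) f i z) (\sum_(i < n) df i).
Proof.
move=> H; have -> : (fun z => \sum_(i < n) f i z) = \sum_(i < n) f i.
  by apply/funext => z; rewrite fct_sumE.
exact: is_derive_sum.
Qed.

Lemma is_derive_add f g x v (df dg : R) :
  is_derive x v f df -> is_derive x v g dg ->
  is_derive x v (fun z => f z + g z) (df + dg).
Proof. by move=> Hf Hg; have H := is_deriveD Hf Hg; exact: H. Qed.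

Lemma is_derive_mul f g x v (df dg : R) :
  is_derive x v f df -> is_derive x v g dg ->
  is_derive x v (fun z => f z * g z) (df * g x + f x * dg).
Proof.
move=> Hf Hg; apply: (is_derive_eq (is_deriveM Hf Hg)).
by rewrite /GRing.scale/= addrC mulrC [X in _ + X]mulrC [dg * _]mulrC mulrC.
Qed.

Lemma is_derive_sqrt f x v (df : R) : 0 < f x ->
  is_derive x v f df ->
  is_derive x v (fun z => Num.sqrt (f z)) (df / (2 * Num.sqrt (f x))).
Proof.
move=> f0 Hf.
have /is_derive_lineP Hl := Hf; apply/is_derive_lineP.
have Hs : is_derive (f (0 *: v + x)) 1 Num.sqrt (2 * Num.sqrt (f x))^-1.
  by rewrite scale0r add0r; exact: is_derive1_sqrt.
by apply: (is_derive_eq (is_derive1_comp Hs Hl)); rewrite mulrC.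
Qed.

Lemma is_derive_inv f x v (df : R) : f x != 0 -> is_derive x v f df ->
  is_derive x v (fun z => (f z)^-1) (- df / f x ^+ 2).
Proof.
move=> f0 [H1 H2]; apply: DeriveDef; first exact: derivableV.
by rewrite deriveV// H2 /GRing.scale/= mulrC mulrN mulNr.
Qed.

Lemma derivable_bigprod (I : Type) (r : seq I) (f : I -> V -> R) x v :
  (forall i, derivable (f i) x v) ->
  derivable (fun z => \prod_(i <- r) f i z) x v.
Proof.
move=> H; elim: r => [|i r IH].
  under [X in derivable X]eq_fun do rewrite big_nil.
  exact: derivable_cst.
under [X in derivable X]eq_fun do rewrite big_cons.
exact: derivableM.
Qed.

Lemma derivable_bigsum (I : Type) (r : seq I) (f : I -> V -> R) x v :
  (forall i, derivable (f i) x v) ->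
  derivable (fun z => \sum_(i <- r) f i z) x v.
Proof.
move=> H; elim: r => [|i r IH].
  under [X in derivable X]eq_fun do rewrite big_nil.
  exact: derivable_cst.
under [X in derivable X]eq_fun do rewrite big_cons.
exact: derivableD.
Qed.

Lemma derivable_det n (A : V -> 'M[R]_n) x v :
  (forall i j, derivable (fun z => A z i j) x v) ->
  derivable (fun z => \det (A z)) x v.
Proof.
move=> H; rewrite /determinant; apply: derivable_bigsum => s.
apply: derivableM; first exact: derivable_cst.
exact: derivable_bigprod.
Qed.

(** By Cramer's rule the entries of the inverse are rational in those of [A]. *)
Lemma derivable_invmx n (A : V -> 'M[R]_n) x v :
  (\forall z \near x, A z \in unitmx) ->
  (forall i j, derivable (fun z => A z i j) x v) ->
  forall i j, derivable (fun z => invmx (A z) i j) x v.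
Proof.
move=> Au H i j.
have Ax : A x \in unitmx := nbhs_singleton Au.
apply: (@near_eq_derivable _ _ _ (fun z => (\det (A z))^-1 * cofactor (A z) j i)).
  by near=> z; rewrite /invmx (near Au z)// !mxE.
apply: derivableM.
  apply: derivableV; first by rewrite -unitfE -unitmxE.
  exact: derivable_det.
apply: derivableM; first exact: derivable_cst.
apply: derivable_det => k l.
under [X in derivable X]eq_fun do rewrite !mxE.
exact: H.
Unshelve. all: by end_near. Qed.

End DirectionalDerivatives.

(** * Covectors and quadratic forms *)

Section QuadraticForms.
Set Implicit Arguments.
Unset Strict Implicit.
Context {R : realType} {n : nat}.
Implicit Types (A : 'M[R]_n) (c d u v w : 'I_n -> R).

Definition pairing c v : R := \sum_(i < n) c i * v i.
Definition lower A v : 'I_n -> R := fun i => \sum_(j < n) A i j * v j.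
Definition bilin A u v : R := \sum_(i < n) \sum_(j < n) A i j * u i * v j.

Lemma pairingC c v : pairing c v = pairing v c.
Proof. by apply: eq_bigr => i _; rewrite mulrC. Qed.

Lemma pairing_lin c k l u v :
  pairing c (fun i => k * u i + l * v i) = k * pairing c u + l * pairing c v.
Proof. rewrite /pairing !mulr_sumr -big_split; apply: eq_bigr => i _ /=; ring. Qed.

Lemma pairing_ebase c l : pairing c (ebase l 0) = c l.
Proof.
rewrite /pairing (bigD1 l)//= big1 => [|i il]; rewrite /ebase mxE.
  by rewrite !eqxx mulr1 addr0.
by rewrite (negbTE il) andbF mulr0.
Qed.

Lemma bilin_lowerr A u v : bilin A u v = pairing u (lower A v).
Proof.
apply: eq_bigr => i _; rewrite mulr_sumr; apply: eq_bigr => j _; ring.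
Qed.

Lemma bilinC A u v : A^T = A -> bilin A u v = bilin A v u.
Proof.
move=> sA; rewrite /bilin exchange_big; apply: eq_bigr => i _.
by apply: eq_bigr => j _; rewrite -{1}sA mxE; ring.
Qed.

Lemma bilin_lowerl A u v : A^T = A -> bilin A u v = pairing (lower A u) v.
Proof. by move=> sA; rewrite bilinC// bilin_lowerr pairingC. Qed.

Lemma bilin_linr A k l u v w :
  bilin A u (fun i => k * v i + l * w i) = k * bilin A u v + l * bilin A u w.
Proof.
rewrite /bilin !mulr_sumr -big_split; apply: eq_bigr => i _ /=.
rewrite !mulr_sumr -big_split; apply: eq_bigr => j _ /=; ring.
Qed.

Lemma bilin_ebase A u l : A^T = A -> bilin A u (ebase l 0) = lower A u l.
Proof. by move=> sA; rewrite bilin_lowerl// pairing_ebase. Qed.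

Lemma lowerM A B v : lower A (lower B v) = lower (A *m B) v.
Proof.
apply/funext => i; rewrite /lower.
under eq_bigr do rewrite mulr_sumr.
rewrite exchange_big; apply: eq_bigr => j _; rewrite mxE mulr_suml.
by apply: eq_bigr => k _; ring.
Qed.

Lemma lower1 v : lower 1%:M v = v.
Proof.
apply/funext => i; rewrite /lower (bigD1 i)//= big1 => [|j ji]; rewrite mxE.
  by rewrite eqxx mul1r addr0.
by rewrite eq_sym (negbTE ji) mul0r.
Qed.

Lemma lower_invmx A c : A \in unitmx -> lower A (lower (invmx A) c) = c.
Proof. by move=> uA; rewrite lowerM mulmxV// lower1. Qed.

Lemma invmx_lower A v : A \in unitmx -> lower (invmx A) (lower A v) = v.
Proof. by move=> uA; rewrite lowerM mulVmx// lower1. Qed.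

Lemma vector_neq0 v : (exists i, v i != 0) \/ v = fun=> 0.
Proof.
have [/existsP|] := boolP [exists i, v i != 0]; first by left.
rewrite negb_exists => /forallP v0; right; apply/funext => i.
exact/eqP/negPn.
Qed.

Lemma bilin0r A u : bilin A u (fun=> 0) = 0.
Proof. by rewrite /bilin big1// => i _; rewrite big1// => j _; rewrite mulr0. Qed.

Lemma positive_definite_bilin A v : positive_definite A ->
  (exists i, v i != 0) -> 0 < bilin A v v.
Proof.
move=> pA [i vi].
have /pA : (\row_j v j) != 0.
  apply: contraNneq vi => /rowP/(_ i); by rewrite !mxE => ->.
by under eq_bigr do under eq_bigr do rewrite !mxE.
Qed.

Lemma bilin_ge0 A v : positive_definite A -> 0 <= bilin A v v.
Proof.
move=> pA; have [v0|->] := vector_neq0 v; last by rewrite bilin0r.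
exact/ltW/positive_definite_bilin.
Qed.

Lemma positive_definite_unitmx A : positive_definite A -> A \in unitmx.
Proof.
move=> pA; rewrite -row_free_unit -kermx_eq0; apply: contraT.
case/rowV0Pn => v /sub_kermxP vA v0; have := pA _ v0.
suff -> : \sum_(i < n) \sum_(j < n) A i j * v 0 i * v 0 j = (v *m A *m v^T) 0 0.
  by rewrite vA mul0mx mxE ltxx.
rewrite mxE exchange_big; apply: eq_bigr => j _.
rewrite !mxE mulr_suml; apply: eq_bigr => i _; ring.
Qed.

Lemma rV_neq0 (y : 'rV[R]_n) : y != 0 -> exists i, y 0 i != 0.
Proof.
move=> y0; have [//|y_eq0] := vector_neq0 (y 0).
by case/eqP: y0; apply/rowP => i; rewrite y_eq0 mxE.
Qed.

(** The Cauchy-Schwarz inequality for [v] and the vector [B] dual to [c]: the form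
    is nonnegative on [bilin A v v * B - pairing c v * v]. *)
Lemma pairing_sqr_le A c v : A^T = A -> positive_definite A ->
  pairing c v ^+ 2 <= pairing c (lower (invmx A) c) * bilin A v v.
Proof.
move=> sA pA; have uA := positive_definite_unitmx pA.
set B := lower (invmx A) c.
have Bv w : bilin A B w = pairing c w by rewrite bilin_lowerl// /B lower_invmx.
have [vn0|->] := vector_neq0 v; last first.
  by rewrite bilin0r -Bv bilin0r mulr0 expr0n.
have vv := positive_definite_bilin pA vn0.
pose w i := bilin A v v * B i + - pairing c v * v i.
have := bilin_ge0 w pA.
rewrite {2}/w bilin_linr ![bilin A w _]bilinC// !bilin_linr.
rewrite [bilin A v B]bilinC// !Bv => H.
rewrite -subr_ge0 -(pmulr_rge0 _ vv).
move: H; congr (0 <= _); ring.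
Qed.

End QuadraticForms.

(** * Derivatives on the tangent bundle of a coordinate domain *)

Section TangentDerivatives.
Set Implicit Arguments.
Unset Strict Implicit.
Context {R : realType} {n : nat}.
Implicit Types (x y u v : 'rV[R]_n) (z w : 'rV[R]_n * 'rV[R]_n).

Lemma is_derive_base (g : 'rV[R]_n -> R) z w dg :
  is_derive z.1 w.1 g dg -> is_derive z w (fun z' => g z'.1) dg.
Proof. by move=> /is_derive_lineP H; apply/is_derive_lineP. Qed.

Lemma is_derive_base_vertical (g : 'rV[R]_n -> R) z v :
  is_derive z (0, v) (fun z' => g z'.1) 0.
Proof. exact/is_derive_base/is_derive0. Qed.

Lemma is_derive_fiber z w i :
  is_derive z w (fun z' => z'.2 0 i) (w.2 0 i).
Proof.
apply/is_derive_lineP.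
have -> : (fun h : R => (h *: w + z).2 0 i) = fun h => h * w.2 0 i + z.2 0 i.
  by apply/funext => h; rewrite !mxE.
have H := is_derive_add (is_derive_mul (is_derive_id (0 : R) 1)
  (is_derive_cst (w.2 0 i) (0 : R) 1)) (is_derive_cst (z.2 0 i) (0 : R) 1).
by apply: (is_derive_eq H) => /=; ring.
Qed.

Lemma is_derive_pairing_vertical (c : 'rV[R]_n -> 'I_n -> R) z v :
  is_derive z (0, v) (fun z' => pairing (c z'.1) (z'.2 0)) (pairing (c z.1) (v 0)).
Proof.
apply: is_derive_bigsum => i.
apply: (is_derive_eq (is_derive_mul (is_derive_base_vertical (fun x => c x i) z v)
  (is_derive_fiber z _ i))).
by rewrite /= mul0r add0r.
Qed.

Lemma is_derive_bilin_vertical (A : 'rV[R]_n -> 'M[R]_n) z v :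
  (A z.1)^T = A z.1 ->
  is_derive z (0, v) (fun z' => bilin (A z'.1) (z'.2 0) (z'.2 0))
    (2 * bilin (A z.1) (z.2 0) (v 0)).
Proof.
move=> sA; have H := is_derive_bigsum (fun i => is_derive_bigsum (fun j =>
  is_derive_mul (is_derive_mul (is_derive_base_vertical (fun x => A x i j) z v)
  (is_derive_fiber z (0, v) i)) (is_derive_fiber z (0, v) j))).
apply: (is_derive_eq H) => /=.
rewrite mulr2n mulrDl mul1r {1}bilinC// /bilin -big_split; apply: eq_bigr => i _.
rewrite -big_split; apply: eq_bigr => j _ /=; ring.
Qed.

Lemma is_derive_pairing_horizontal (c : 'rV[R]_n -> 'I_n -> R) dc z u :
  (forall i, is_derive z.1 u (fun x => c x i) (dc i)) ->
  is_derive z (u, 0) (fun z' => pairing (c z'.1) (z'.2 0)) (pairing dc (z.2 0)).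
Proof.
move=> H; apply: is_derive_bigsum => i.
have Hi := @is_derive_base (fun x => c x i) z (u, 0) _ (H i).
apply: (is_derive_eq (is_derive_mul Hi (is_derive_fiber z (u, 0) i))).
by rewrite /= mxE mulr0 addr0.
Qed.

Lemma is_derive_bilin_horizontal (A : 'rV[R]_n -> 'M[R]_n) (dA : 'M[R]_n) z u :
  (forall i j, is_derive z.1 u (fun x => A x i j) (dA i j)) ->
  is_derive z (u, 0) (fun z' => bilin (A z'.1) (z'.2 0) (z'.2 0))
    (bilin dA (z.2 0) (z.2 0)).
Proof.
move=> H; apply: is_derive_bigsum => i; apply: is_derive_bigsum => j.
have Hij := @is_derive_base (fun x => A x i j) z (u, 0) _ (H i j).
apply: (is_derive_eq (is_derive_mul (is_derive_mul Hij
  (is_derive_fiber z (u, 0) i)) (is_derive_fiber z (u, 0) j))).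
by rewrite /= !mxE !mulr0 !addr0.
Qed.

End TangentDerivatives.

(** * The algebraic identity *)

(** The component with index [l] of the linear system for the spray, once all sums
    over indices have been carried out. [V], [Vy] and [Vb] are the candidate
    solution lowered by [a] and paired with [y] and with [b]; [yl], [bl], [S], [rl],
    [sl] and [G] are the components [y_l], [b_l], [s_(l0)], [r_l], [s_l] and the
    lowered spray of [alpha]; [Gy] and [Gb] are the pairings of that spray with [y]
    and with [b]. The functions [dA], [dB] and [dT] are the fibre derivatives of the
    partial derivatives of [F^2] with respect to [alpha^2], [beta] and [b^2]. *)
Lemma contracted_spray_equation (K : realFieldType)
    (al f f1 f2 f12 f22 s t yl bl S rl sl G Gy Gb r00 r0 s0 r : K) :
  let D := f - s * f2 in
  let Delta := D + (t - s ^+ 2) * f22 in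
  let Q := f2 / D in
  let R' := f1 / D in
  let Theta := (D * f2 - s * f * f22) / (2 * f * Delta) in
  let Psi := f22 / (2 * Delta) in
  let Pi := (D * f12 - s * f1 * f22) / (D * Delta) in
  let Omega := 2 * f1 / f - (s * f + (t - s ^+ 2) * f2) / f * Pi in
  let c := - (2 * al * Q * s0) + r00 + 2 * al ^+ 2 * R' * r in
  let q := (Theta * c + al * Omega * (r0 + s0)) / al in
  let u := Psi * c + al * Pi * (r0 + s0) in
  let V := G + al * Q * S + q * yl + u * bl - al ^+ 2 * R' * (rl + sl) in
  let Vy := Gy + q * al ^+ 2 + u * (s * al) - al ^+ 2 * R' * (r0 + s0) in
  let Vb := Gb + al * Q * s0 + q * (s * al) + u * t - al ^+ 2 * R' * r in
  let ds (v w : K) := (w - s * v / al) / al in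
  let dA (v w : K) := (f2 * D - s * f * f22) * ds v w in
  let dB (v w : K) := 2 * f * f2 * v / al + 2 * al * (f2 ^+ 2 + f * f22) * ds v w in
  let dT (v w : K) := 4 * f * f1 * v + 2 * al ^+ 2 * (f2 * f1 + f * f12) * ds v w in
  al != 0 -> f != 0 -> D != 0 -> Delta != 0 ->
  4^-1 * (dA yl bl * (4 * Gy) + dB yl bl * (r00 + 2 * Gb) + dT yl bl * (2 * (r0 + s0))
    + f * D * (4 * G) + 2 * al * f * f2 * (2 * S)
    - 2 * al ^+ 2 * f * f1 * (2 * (rl + sl))) =
  2^-1 * (2 * (f * D) * V + 2 * dA Vy Vb * yl + dB Vy Vb * bl).
Proof.
move=> /= al0 f0 D0 Delta0.
by field; rewrite al0 f0 D0 Delta0.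
Qed.

(** * Riemannian geometry in a coordinate domain *)

Section RiemannianData.
Set Implicit Arguments.
Unset Strict Implicit.
Context {R : realType} {n : nat}.
Variables (X : set 'rV[R]_n) (a : 'rV[R]_n -> 'M[R]_n) (b : 'rV[R]_n -> 'rV[R]_n).
Hypothesis openX : open X.
Hypothesis a_sym : forall x, X x -> (a x)^T = a x.
Hypothesis a_pos : forall x, X x -> positive_definite (a x).
Hypothesis a_derivable : forall x, X x ->
  forall v i j, derivable (fun w => a w i j) x v.
Hypothesis b_derivable : forall x, X x ->
  forall v i, derivable (fun w => b w 0 i) x v.
Implicit Types (x y u v w : 'rV[R]_n) (z : 'rV[R]_n * 'rV[R]_n) (i j k l : 'I_n).

Definition dmetric k x : 'M[R]_n := \matrix_(i, j) pd k (fun w => a w i j) x.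
Definition dform k x i : R := pd k (fun w => b w 0 i) x.

Lemma dmetric_sym k x : X x -> (dmetric k x)^T = dmetric k x.
Proof.
move=> Xx; apply/matrixP => i j; rewrite !mxE; apply: near_eq_derive.
near=> w; have Xw : X w by near: w; exact: open_nbhs_nbhs.
by rewrite -[in LHS](a_sym Xw) mxE.
Unshelve. all: by end_near. Qed.

Lemma dmetricC k x i j : X x -> dmetric k x i j = dmetric k x j i.
Proof. by move=> Xx; rewrite -{1}dmetric_sym// mxE. Qed.

Lemma a_unit x : X x -> a x \in unitmx.
Proof. by move=> Xx; exact/positive_definite_unitmx/a_pos. Qed.

Lemma ainv_sym x : X x -> (ainv a x)^T = ainv a x.
Proof. by move=> Xx; rewrite /ainv trmx_inv a_sym. Qed.

Lemma lower_bup x : X x -> lower (a x) (bup a b x) = b x 0.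
Proof. by move=> Xx; apply: lower_invmx; exact: a_unit. Qed.

Lemma bsq_bup x : bsq a b x = pairing (b x 0) (bup a b x).
Proof. exact: (bilin_lowerr (ainv a x) (b x 0) (b x 0)). Qed.

Lemma bilin_bup x (v : 'I_n -> R) : X x -> bilin (a x) (bup a b x) v = pairing (b x 0) v.
Proof. by move=> Xx; rewrite bilin_lowerl ?a_sym// lower_bup. Qed.

Lemma near_X x : X x -> \forall w \near x, X w.
Proof. by move=> Xx; exact: open_nbhs_nbhs. Qed.

(** Differentiating [b_i = a_(ij) b^j] expresses the derivative of [b^i] lowered
    by [a], which is all that [b^2 = b_i b^i] requires; the derivative of the
    inverse matrix is never made explicit. *)
Lemma is_derive_bsq x k : X x ->
  is_derive x (ebase k) (bsq a b)
    (2 * pairing (dform k x) (bup a b x) - bilin (dmetric k x) (bup a b x) (bup a b x)).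
Proof.
move=> Xx.
have dup i : derivable (fun w => bup a b w i) x (ebase k).
  apply: derivable_bigsum => j; apply: derivableM; last exact: b_derivable.
  apply: derivable_invmx; last exact: a_derivable.
  by near=> w; apply: a_unit; near: w; exact: near_X.
pose db i := 'D_(ebase k) (fun w => bup a b w i) x.
have Hup i : is_derive x (ebase k) (fun w => bup a b w i) (db i).
  exact: derivableP.
have Hb i : is_derive x (ebase k) (fun w => b w 0 i) (dform k x i).
  exact/derivableP/b_derivable.
have Ha i j : is_derive x (ebase k) (fun w => a w i j) (dmetric k x i j).
  by rewrite mxE; exact/derivableP/a_derivable.
have dformE i : dform k x i =
    lower (dmetric k x) (bup a b x) i + lower (a x) db i.
  have H : is_derive x (ebase k) (fun w => lower (a w) (bup a b w) i)
      (lower (dmetric k x) (bup a b x) i + lower (a x) db i).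
    apply: is_derive_eq.
      exact: (is_derive_bigsum (fun j => is_derive_mul (Ha i j) (Hup j))).
    by rewrite -big_split.
  rewrite -[RHS](@derive_val _ _ _ _ _ _ _ H); apply: near_eq_derive.
  near=> w; have Xw : X w by near: w; exact: near_X.
  by rewrite lower_bup.
have -> : bsq a b = fun w => pairing (b w 0) (bup a b w).
  by apply/funext => w; exact: bsq_bup.
apply: is_derive_eq.
  exact: (is_derive_bigsum (fun j => is_derive_mul (Hb j) (Hup j))).
rewrite big_split /=.
rewrite -/(pairing (dform k x) (bup a b x)) -/(pairing (b x 0) db).
have -> : pairing (b x 0) db = bilin (a x) (bup a b x) db by rewrite bilin_bup.
have dE : pairing (dform k x) (bup a b x) =
    bilin (dmetric k x) (bup a b x) (bup a b x) + bilin (a x) (bup a b x) db.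
  rewrite !bilin_lowerr -[RHS]mul1r mulrDr -pairing_lin pairingC.
  by congr pairing; apply/funext => i; rewrite dformE !mul1r.
by rewrite dE; ring.
Unshelve. all: by end_near. Qed.

(** The Christoffel symbols of the first kind. *)
Definition christoffel_lower x l i j : R :=
  2^-1 * (dmetric i x l j + dmetric j x i l - dmetric l x i j).

Lemma pairing_christoffel x i j : X x ->
  \sum_(k < n) b x 0 k * christoffel a x k i j =
  pairing (bup a b x) (fun l => christoffel_lower x l i j).
Proof.
move=> Xx; rewrite -/(pairing _ (fun k => christoffel a x k i j)).
have -> : (fun k => christoffel a x k i j) =
    lower (ainv a x) (fun l => christoffel_lower x l i j).
  apply/funext => k; rewrite /christoffel mulr_sumr; apply: eq_bigr => l _.
  by rewrite /christoffel_lower !mxE; ring.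
by rewrite -bilin_lowerr bilin_lowerl// ainv_sym.
Qed.

Lemma christoffel_lowerC x l i j : X x ->
  christoffel_lower x l i j = christoffel_lower x l j i.
Proof.
move=> Xx; rewrite /christoffel_lower.
rewrite [dmetric i x l j]dmetricC// [dmetric j x i l]dmetricC//.
by rewrite [dmetric l x i j]dmetricC//; ring.
Qed.

Lemma bcovE x i j : X x -> bcov a b x i j =
  dform j x i - pairing (bup a b x) (fun l => christoffel_lower x l i j).
Proof. by move=> Xx; rewrite /bcov pairing_christoffel. Qed.

Lemma s_llE x i j : X x -> s_ll a b x i j = 2^-1 * (dform j x i - dform i x j).
Proof.
move=> Xx; rewrite /s_ll !bcovE//.
have -> : (fun l => christoffel_lower x l j i) = fun l => christoffel_lower x l i j.
  by apply/funext => l; rewrite christoffel_lowerC.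
by congr (_ * _); ring.
Qed.

(** The connection of [a] is metric, so that differentiating [b^2] amounts to
    differentiating covariantly the form alone: the result is [2 b^j b_(j|k)]. *)
Lemma derive_bsq x k : X x ->
  is_derive x (ebase k) (bsq a b) (2 * (r_l a b x k + s_l a b x k)).
Proof.
move=> Xx; apply: (is_derive_eq (is_derive_bsq k Xx)).
have -> : r_l a b x k + s_l a b x k =
    pairing (bup a b x) (fun j => bcov a b x j k).
  rewrite -big_split; apply: eq_bigr => j _ /=.
  by rewrite /r_ll /s_ll; field.
have -> : (fun j => bcov a b x j k) = fun j => 1 * dform k x j +
    - 1 * pairing (bup a b x) (fun l => christoffel_lower x l j k).
  by apply/funext => j; rewrite bcovE//; ring.
rewrite pairing_lin [pairing _ (dform k x)]pairingC.
(* Of the three terms of the Christoffel symbols, two cancel by symmetry. *)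
set S := pairing _ (fun j => pairing _ _).
suff -> : S = 2^-1 * bilin (dmetric k x) (bup a b x) (bup a b x) by field.
pose T := \sum_(i < n) \sum_(j < n) dmetric i x j k * bup a b x i * bup a b x j.
have ->: S = 2^-1 * (T + bilin (dmetric k x) (bup a b x) (bup a b x) -
   \sum_(j < n) \sum_(i < n) dmetric i x j k * bup a b x i * bup a b x j).
  rewrite /S /T /bilin mulrBr mulrDr !mulr_sumr -big_split -sumrB.
  apply: eq_bigr => i _ /=; rewrite !mulr_sumr -big_split -sumrB.
  apply: eq_bigr => j _ /=; rewrite /christoffel_lower; ring.
by rewrite [in X in _ - X]exchange_big addrAC subrr add0r.
Qed.

(** The spray of the Riemannian metric [a], with its index lowered. *)
Definition spray_lower z l : R :=
  2^-1 * (\sum_(k < n) z.2 0 k * lower (dmetric k z.1) (z.2 0) l)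
  - 4^-1 * bilin (dmetric l z.1) (z.2 0) (z.2 0).

Lemma christoffel_spray z l : X z.1 ->
  \sum_(i < n) \sum_(j < n) christoffel_lower z.1 l i j * z.2 0 i * z.2 0 j =
  2 * spray_lower z l.
Proof.
move=> Xz; rewrite /spray_lower.
have -> : \sum_(i < n) \sum_(j < n) christoffel_lower z.1 l i j * z.2 0 i * z.2 0 j =
  2^-1 * (\sum_(k < n) z.2 0 k * lower (dmetric k z.1) (z.2 0) l) +
  2^-1 * (\sum_(j < n) \sum_(i < n) dmetric j z.1 i l * z.2 0 i * z.2 0 j) -
  2^-1 * bilin (dmetric l z.1) (z.2 0) (z.2 0).
  rewrite [in RHS]exchange_big /lower /bilin !mulr_sumr -big_split -sumrB.
  apply: eq_bigr => i _ /=; rewrite !mulr_sumr -big_split -sumrB.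
  apply: eq_bigr => j _ /=; rewrite /christoffel_lower; ring.
have -> : \sum_(j < n) \sum_(i < n) dmetric j z.1 i l * z.2 0 i * z.2 0 j =
    \sum_(k < n) z.2 0 k * lower (dmetric k z.1) (z.2 0) l.
  apply: eq_bigr => j _; rewrite /lower mulr_sumr; apply: eq_bigr => i _.
  by rewrite dmetricC//; ring.
by field.
Qed.

(** Euler's identity: [alpha^2] is homogeneous of degree two in [y]. *)
Lemma pairing_spray_lower z :
  \sum_(k < n) z.2 0 k * bilin (dmetric k z.1) (z.2 0) (z.2 0) =
  4 * pairing (z.2 0) (spray_lower z).
Proof.
have H : pairing (z.2 0) (fun l => \sum_(k < n) z.2 0 k * lower (dmetric k z.1) (z.2 0) l)
   = \sum_(k < n) z.2 0 k * bilin (dmetric k z.1) (z.2 0) (z.2 0).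
  rewrite /pairing; under eq_bigr do rewrite mulr_sumr.
  rewrite exchange_big; apply: eq_bigr => k _; rewrite bilin_lowerr mulr_sumr.
  by apply: eq_bigr => l _; ring.
have -> : spray_lower z = fun l =>
    2^-1 * (\sum_(k < n) z.2 0 k * lower (dmetric k z.1) (z.2 0) l) +
    - 4^-1 * bilin (dmetric l z.1) (z.2 0) (z.2 0).
  by apply/funext => l; rewrite mulNr.
by rewrite pairing_lin H /pairing; field.
Qed.

(** The derivative of [beta] along the base direction [y] differs from the covariant
    one by a Christoffel term, which is the pairing of [b] with the spray. *)
Lemma form_derivative_r00 z : X z.1 ->
  \sum_(k < n) z.2 0 k * pairing (dform k z.1) (z.2 0) =
  r_00 a b z + 2 * pairing (bup a b z.1) (spray_lower z).
Proof.
move=> Xz.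
have -> : r_00 a b z = \sum_(k < n) z.2 0 k * pairing (dform k z.1) (z.2 0) -
  \sum_(i < n) \sum_(j < n) pairing (bup a b z.1)
    (fun l => christoffel_lower z.1 l i j) * z.2 0 i * z.2 0 j.
  have -> : \sum_(k < n) z.2 0 k * pairing (dform k z.1) (z.2 0) =
      2^-1 * (\sum_(i < n) \sum_(j < n) dform j z.1 i * z.2 0 i * z.2 0 j) +
      2^-1 * (\sum_(i < n) \sum_(j < n) dform i z.1 j * z.2 0 i * z.2 0 j).
    rewrite [X in _ * X + _]exchange_big -mulrDr -big_split mulr_sumr.
    apply: eq_bigr => k _ /=; rewrite /pairing -big_split !mulr_sumr.
    by apply: eq_bigr => i _ /=; field.
  rewrite /r_00 !mulr_sumr -big_split -sumrB; apply: eq_bigr => i _ /=.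
  rewrite !mulr_sumr -big_split -sumrB; apply: eq_bigr => j _ /=.
  rewrite /r_ll !bcovE//.
  have -> : (fun l => christoffel_lower z.1 l j i) =
      fun l => christoffel_lower z.1 l i j.
    by apply/funext => l; rewrite christoffel_lowerC.
  by field.
suff -> : \sum_(i < n) \sum_(j < n) pairing (bup a b z.1)
    (fun l => christoffel_lower z.1 l i j) * z.2 0 i * z.2 0 j =
    2 * pairing (bup a b z.1) (spray_lower z) by ring.
rewrite /pairing mulr_sumr.
under eq_bigr => i _ do under eq_bigr => j _ do rewrite !mulr_suml.
under eq_bigr => i _ do rewrite exchange_big.
rewrite exchange_big; apply: eq_bigr => l _ /=.
rewrite mulrCA -christoffel_spray// mulr_sumr; apply: eq_bigr => i _.
by rewrite mulr_sumr; apply: eq_bigr => j _; ring.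
Qed.

(** The Christoffel symbols are symmetric, hence disappear from the exterior
    derivative of the form. *)
Lemma form_curl z l : X z.1 ->
  \sum_(k < n) z.2 0 k * dform k z.1 l - pairing (dform l z.1) (z.2 0) =
  2 * pairing (s_ll a b z.1 l) (z.2 0).
Proof.
move=> Xz; rewrite /pairing mulr_sumr -sumrB; apply: eq_bigr => k _.
by rewrite s_llE//; field.
Qed.

(** * Sprays as solutions of a linear system *)

Definition slit z : Prop := X z.1 /\ z.2 != 0.

Lemma near_base z : X z.1 -> \forall z' \near z, X z'.1.
Proof. by case: z => x y Xx; exact: (cvg_fst (near_X Xx)). Qed.

Lemma near_slit z : slit z -> \forall z' \near z, slit z'.
Proof.
case: z => x y [/= Xx y0].
have H : \forall z' \near (x, y), z'.2 != 0.
  have y_lim : snd @ nbhs (x, y) --> y by exact: cvg_snd.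
  exact: (cvgr_neq0 y y_lim y0).
near=> z'; split; near: z' => //; exact: near_base.
Unshelve. all: by end_near. Qed.

Definition alpha2 z : R := bilin (a z.1) (z.2 0) (z.2 0).

Lemma alpha2_gt0 z : slit z -> 0 < alpha2 z.
Proof. by case=> Xz z0; apply: positive_definite_bilin; [exact: a_pos | exact: rV_neq0]. Qed.

Lemma alpha_sqr z : X z.1 -> alpha a z ^+ 2 = alpha2 z.
Proof. by move=> Xz; apply: sqr_sqrtr; apply: bilin_ge0; exact: a_pos. Qed.

Lemma alpha_gt0 z : slit z -> 0 < alpha a z.
Proof. by move=> Oz; rewrite sqrtr_gt0; exact: alpha2_gt0. Qed.

Lemma alpha_neq0 z : slit z -> alpha a z != 0.
Proof. by move=> Oz; rewrite gt_eqF// alpha_gt0. Qed.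

Lemma alpha2_horizontal z k : X z.1 ->
  is_derive z (ebase k, 0) alpha2 (bilin (dmetric k z.1) (z.2 0) (z.2 0)).
Proof.
move=> Xz; apply: is_derive_bilin_horizontal => i j.
by rewrite mxE; exact/derivableP/a_derivable.
Qed.

Lemma beta_horizontal z k : X z.1 ->
  is_derive z (ebase k, 0) (beta b) (pairing (dform k z.1) (z.2 0)).
Proof.
move=> Xz; apply: (@is_derive_pairing_horizontal _ _ (fun x => b x 0)) => i.
exact/derivableP/b_derivable.
Qed.

Section Spray.
Variable F : 'rV[R]_n * 'rV[R]_n -> R.

Definition spray_rhs z l : R :=
  \sum_(k < n) pdy l (pdx k (sqF F)) z * z.2 0 k - pdx l (sqF F) z.

(** In this form the inverse is cancelled by multiplying with the fundamental
    tensor. *)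
Lemma sprayE z : spray F z =
  lower (invmx (fundamental_tensor F z)) (fun l => 4^-1 * spray_rhs z l).
Proof.
apply/funext => i; rewrite /spray mulr_sumr; apply: eq_bigr => l _.
by rewrite /spray_rhs; ring.
Qed.

End Spray.

Lemma sqF_alpha_near z : X z.1 -> \near z, alpha2 z = sqF (alpha a) z.
Proof.
by move=> Xz; near=> z'; rewrite /sqF alpha_sqr//; near: z'; exact: near_base.
Unshelve. all: by end_near. Qed.

Lemma pdx_sqF_alpha k z : X z.1 ->
  pdx k (sqF (alpha a)) z = bilin (dmetric k z.1) (z.2 0) (z.2 0).
Proof.
move=> Xz; rewrite /pdx -(near_eq_derive _ (sqF_alpha_near Xz)).
exact: (@derive_val _ _ _ _ _ _ _ (alpha2_horizontal k Xz)).
Qed.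

Lemma fundamental_alpha z : X z.1 -> fundamental_tensor (alpha a) z = a z.1.
Proof.
move=> Xz; apply/matrixP => i j; rewrite mxE.
have H : \forall z' \near z, 2 * pairing (lower (a (z' : 'rV[R]_n * 'rV[R]_n).1)
    (ebase i 0)) (z'.2 0) = pdy i (sqF (alpha a)) z'.
  near=> z'; have Xz' : X z'.1 by near: z'; exact: near_base.
  rewrite /pdy -(near_eq_derive _ (sqF_alpha_near Xz')).
  have D := @is_derive_bilin_vertical _ _ a z' (ebase i) (a_sym Xz').
  by rewrite (@derive_val _ _ _ _ _ _ _ D) bilin_lowerr pairingC.
rewrite /pdy -(near_eq_derive _ H).
have D := is_derive_mul (is_derive_cst (2 : R) z (0, ebase j))
  (is_derive_pairing_vertical (fun x => lower (a x) (ebase i 0)) z (ebase j)).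
rewrite (@derive_val _ _ _ _ _ _ _ D) pairing_ebase.
rewrite mul0r add0r /= mulKf ?pnatr_eq0//.
by rewrite /lower -[LHS]/(pairing (a z.1 j) (ebase i 0)) pairing_ebase -{1}a_sym// mxE.
Unshelve. all: by end_near. Qed.

Lemma lower_spray_alpha z : X z.1 ->
  lower (a z.1) (spray (alpha a) z) = spray_lower z.
Proof.
move=> Xz; rewrite sprayE fundamental_alpha// lower_invmx ?a_unit//.
apply/funext => l; rewrite /spray_rhs /spray_lower pdx_sqF_alpha//.
have E k : pdy l (pdx k (sqF (alpha a))) z = 2 * lower (dmetric k z.1) (z.2 0) l.
  have H : \forall z' \near z, bilin (dmetric k (z' : 'rV[R]_n * 'rV[R]_n).1)
      (z'.2 0) (z'.2 0) = pdx k (sqF (alpha a)) z'.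
    by near=> z'; rewrite pdx_sqF_alpha//; near: z'; exact: near_base.
  rewrite /pdy -(near_eq_derive _ H).
  have D := @is_derive_bilin_vertical _ _ (dmetric k) z (ebase l) (dmetric_sym k Xz).
  by rewrite (@derive_val _ _ _ _ _ _ _ D) bilin_ebase// dmetric_sym.
under eq_bigr => k _ do rewrite E.
rewrite mulrBr; congr (_ - _); rewrite !mulr_sumr; apply: eq_bigr => k _.
by field.
Unshelve. all: by end_near. Qed.

(** * First and second derivatives of the squared metric *)

Section AlphaBetaMetric.
Variables (U : set (R * R)) (phi : R * R -> R).
Hypothesis phi_differentiable : forall p, U p ->
  [/\ differentiable phi p, differentiable (d1 phi) p & differentiable (d2 phi) p].

Definition pt z : R * R := (bsq a b z.1, beta b z / alpha a z).

Hypothesis pt_dom : forall z, slit z -> U (pt z).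
Hypothesis phi_pos : forall z, slit z -> 0 < phi (pt z).

Definition energy z : R := alpha2 z * phi (pt z) ^+ 2.

(** The partial derivatives of [alpha2 * phi (bsq, beta / alpha) ^+ 2] with respect
    to [alpha2], [beta] and [bsq] as independent variables. *)
Definition energy_alpha z : R :=
  phi (pt z) * (phi (pt z) - (pt z).2 * d2 phi (pt z)).
Definition energy_beta z : R := 2 * alpha a z * phi (pt z) * d2 phi (pt z).
Definition energy_bsq z : R := 2 * alpha a z ^+ 2 * phi (pt z) * d1 phi (pt z).

Lemma is_derive_alpha z (w : 'rV[R]_n * 'rV[R]_n) dA : slit z ->
  is_derive z w alpha2 dA -> is_derive z w (alpha a) (dA / (2 * alpha a z)).
Proof. by move=> Oz; apply: is_derive_sqrt; exact: alpha2_gt0. Qed.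

Lemma is_derive_ratio z (w : 'rV[R]_n * 'rV[R]_n) dA dB : slit z ->
  is_derive z w alpha2 dA -> is_derive z w (beta b) dB ->
  is_derive z w (fun z' => beta b z' / alpha a z')
    ((dB - (pt z).2 * dA / (2 * alpha a z)) / alpha a z).
Proof.
move=> Oz HA HB; have a0 := alpha_neq0 Oz.
apply: (is_derive_eq (is_derive_mul HB (is_derive_inv a0 (is_derive_alpha Oz HA)))).
by rewrite /pt /=; field.
Qed.

Lemma is_derive_pt h z (w : 'rV[R]_n * 'rV[R]_n) dA dB dt : slit z -> differentiable h (pt z) ->
  is_derive z w alpha2 dA -> is_derive z w (beta b) dB ->
  is_derive z w (fun z' => bsq a b z'.1) dt ->
  is_derive z w (fun z' => h (pt z')) (d1 h (pt z) * dt +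
    d2 h (pt z) * ((dB - (pt z).2 * dA / (2 * alpha a z)) / alpha a z)).
Proof.
move=> Oz dh HA HB Ht.
exact: (is_derive_comp2 (f := fun z' => bsq a b z'.1)
  (g := fun z' => beta b z' / alpha a z') dh Ht (is_derive_ratio Oz HA HB)).
Qed.

Lemma is_derive_energy z (w : 'rV[R]_n * 'rV[R]_n) dA dB dt : slit z ->
  is_derive z w alpha2 dA -> is_derive z w (beta b) dB ->
  is_derive z w (fun z' => bsq a b z'.1) dt ->
  is_derive z w energy
    (energy_alpha z * dA + energy_beta z * dB + energy_bsq z * dt).
Proof.
move=> Oz HA HB Ht; have a0 := alpha_neq0 Oz.
have [dphi _ _] := phi_differentiable (pt_dom Oz).
have Hp := is_derive_pt Oz dphi HA HB Ht.
apply: (is_derive_eq (is_derive_mul HA (is_derive_mul Hp Hp))).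
rewrite /energy_alpha /energy_beta /energy_bsq -alpha_sqr; last by case: Oz.
by field.
Qed.

(** The derivatives of [beta / alpha] and of the three partial derivatives above
    along a fibre direction [v], as functions of [vy = a(y, v)] and [vb = b(v)]. *)
Definition dratio z (vy vb : R) : R := (vb - (pt z).2 * vy / alpha a z) / alpha a z.

Definition denergy_alpha z vy vb : R :=
  (d2 phi (pt z) * (phi (pt z) - (pt z).2 * d2 phi (pt z))
   - (pt z).2 * phi (pt z) * d2 (d2 phi) (pt z)) * dratio z vy vb.

Definition denergy_beta z vy vb : R :=
  2 * phi (pt z) * d2 phi (pt z) * vy / alpha a z
  + 2 * alpha a z * (d2 phi (pt z) ^+ 2 + phi (pt z) * d2 (d2 phi) (pt z))
    * dratio z vy vb.

Definition denergy_bsq z vy vb : R :=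
  4 * phi (pt z) * d1 phi (pt z) * vy
  + 2 * alpha a z ^+ 2
    * (d2 phi (pt z) * d1 phi (pt z) + phi (pt z) * d2 (d1 phi) (pt z))
    * dratio z vy vb.

Section Vertical.
Variables (z : 'rV[R]_n * 'rV[R]_n) (v : 'rV[R]_n).
Hypothesis Oz : slit z.
Let vy := bilin (a z.1) (z.2 0) (v 0).
Let vb := pairing (b z.1 0) (v 0).

Lemma alpha2_vertical : is_derive z (0, v) alpha2 (2 * vy).
Proof. by apply: is_derive_bilin_vertical; apply: a_sym; case: Oz. Qed.

Lemma beta_vertical : is_derive z (0, v) (beta b) vb.
Proof. exact: (is_derive_pairing_vertical (fun x => b x 0)). Qed.

Lemma alpha_vertical : is_derive z (0, v) (alpha a) (vy / alpha a z).
Proof.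
apply: (is_derive_eq (is_derive_alpha Oz alpha2_vertical)).
by field; exact: alpha_neq0.
Qed.

Lemma pt2_vertical : is_derive z (0, v) (fun z' => (pt z').2) (dratio z vy vb).
Proof.
apply: (is_derive_eq (is_derive_ratio Oz alpha2_vertical beta_vertical)).
by rewrite /dratio; field; exact: alpha_neq0.
Qed.

Lemma pt_vertical h : differentiable h (pt z) ->
  is_derive z (0, v) (fun z' => h (pt z')) (d2 h (pt z) * dratio z vy vb).
Proof.
move=> dh.
apply: (is_derive_eq (is_derive_pt Oz dh alpha2_vertical beta_vertical
  (is_derive_base_vertical (bsq a b) z v))).
by rewrite /dratio; field; exact: alpha_neq0.
Qed.

Lemma energy_alpha_vertical :
  is_derive z (0, v) energy_alpha (denergy_alpha z vy vb).
Proof.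
have [h0 h1 h2] := phi_differentiable (pt_dom Oz).
have H := is_derive_mul (pt_vertical h0) (is_derive_add (pt_vertical h0)
  (is_derive_mul (is_derive_cst (-1 : R) _ _)
    (is_derive_mul pt2_vertical (pt_vertical h2)))).
have -> : energy_alpha = fun z' => phi (pt z') *
    (phi (pt z') + -1 * ((pt z').2 * d2 phi (pt z'))).
  by apply/funext => z'; rewrite /energy_alpha; ring.
by apply: (is_derive_eq H); rewrite /cst /denergy_alpha; ring.
Qed.

Lemma energy_beta_vertical :
  is_derive z (0, v) energy_beta (denergy_beta z vy vb).
Proof.
have [h0 h1 h2] := phi_differentiable (pt_dom Oz).
have H := is_derive_mul (is_derive_mul (is_derive_mul (is_derive_cst (2 : R) _ _)
  alpha_vertical) (pt_vertical h0)) (pt_vertical h2).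
by apply: (is_derive_eq H); rewrite /cst /denergy_beta; ring.
Qed.

Lemma energy_bsq_vertical :
  is_derive z (0, v) energy_bsq (denergy_bsq z vy vb).
Proof.
have [h0 h1 h2] := phi_differentiable (pt_dom Oz).
have H := is_derive_mul (is_derive_mul (is_derive_mul (is_derive_cst (2 : R) _ _)
  (is_derive_mul alpha_vertical alpha_vertical)) (pt_vertical h0)) (pt_vertical h1).
by apply: (is_derive_eq H); rewrite /cst /denergy_bsq; field; exact: alpha_neq0.
Qed.

Lemma energy_vertical :
  is_derive z (0, v) energy (2 * energy_alpha z * vy + energy_beta z * vb).
Proof.
apply: (is_derive_eq (is_derive_energy Oz alpha2_vertical beta_vertical
  (is_derive_base_vertical (bsq a b) z v))).
by ring.
Qed.

End Vertical.

(** Twice the fundamental tensor, in a form that makes sense for arbitrary vectors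
    rather than for the coordinate directions. *)
Definition hessian z (u v : 'I_n -> R) : R :=
  let vy := bilin (a z.1) (z.2 0) v in
  let vb := pairing (b z.1 0) v in
  2 * energy_alpha z * bilin (a z.1) u v
  + 2 * denergy_alpha z vy vb * bilin (a z.1) (z.2 0) u
  + denergy_beta z vy vb * pairing (b z.1 0) u.

Definition energy_along z (u : 'I_n -> R) : R :=
  2 * energy_alpha z * bilin (a z.1) (z.2 0) u + energy_beta z * pairing (b z.1 0) u.

Lemma energy_along_vertical z (u : 'I_n -> R) (v : 'rV[R]_n) : slit z ->
  is_derive z (0, v) (energy_along ^~ u) (hessian z u (v 0)).
Proof.
move=> Oz; have Xz := Oz.1.
have -> : energy_along ^~ u = fun z' => 2 * energy_alpha z' *
    pairing (lower (a z'.1) u) (z'.2 0) + energy_beta z' * pairing (b z'.1 0) u.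
  by apply/funext => z'; rewrite /energy_along bilin_lowerr pairingC.
have H := is_derive_add (is_derive_mul (is_derive_mul (is_derive_cst (2 : R) _ _)
  (energy_alpha_vertical v Oz))
  (is_derive_pairing_vertical (fun x => lower (a x) u) z v))
  (is_derive_mul (energy_beta_vertical v Oz)
    (is_derive_base_vertical (fun x => pairing (b x 0) u) z v)).
apply: (is_derive_eq H); rewrite /cst /hessian.
rewrite -!bilin_lowerl ?a_sym// [bilin _ u (z.2 0)]bilinC ?a_sym//.
by ring.
Qed.

Lemma energy_horizontal z k : slit z ->
  is_derive z (ebase k, 0) energy
    (energy_alpha z * bilin (dmetric k z.1) (z.2 0) (z.2 0)
     + energy_beta z * pairing (dform k z.1) (z.2 0)
     + energy_bsq z * (2 * (r_l a b z.1 k + s_l a b z.1 k))).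
Proof.
move=> Oz; have Xz := Oz.1; apply: is_derive_energy => //.
- exact: alpha2_horizontal.
- exact: beta_horizontal.
- exact: (is_derive_base (z := z) (w := (ebase k, 0)) (derive_bsq k Xz)).
Qed.

Variable F : 'rV[R]_n * 'rV[R]_n -> R.
Hypothesis F_alphabeta : forall z, slit z -> F z = alpha a z * phi (pt z).

Lemma energy_near z : slit z -> \near z, energy z = sqF F z.
Proof.
move=> Oz; near=> z'; have Oz' : slit z' by near: z'; exact: near_slit.
by rewrite /sqF F_alphabeta// exprMn alpha_sqr//; case: Oz'.
Unshelve. all: by end_near. Qed.

Lemma pdy_sqF l z : slit z -> pdy l (sqF F) z = energy_along z (ebase l 0).
Proof.
move=> Oz; rewrite /pdy -(near_eq_derive _ (energy_near Oz)).
exact: (@derive_val _ _ _ _ _ _ _ (energy_vertical (ebase l) Oz)).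
Qed.

Lemma pdx_sqF k z : slit z -> pdx k (sqF F) z =
  energy_alpha z * bilin (dmetric k z.1) (z.2 0) (z.2 0)
     + energy_beta z * pairing (dform k z.1) (z.2 0)
     + energy_bsq z * (2 * (r_l a b z.1 k + s_l a b z.1 k)).
Proof.
move=> Oz; rewrite /pdx -(near_eq_derive _ (energy_near Oz)).
exact: (@derive_val _ _ _ _ _ _ _ (energy_horizontal k Oz)).
Qed.

Lemma fundamental_tensorE z i j : slit z ->
  fundamental_tensor F z i j = 2^-1 * hessian z (ebase i 0) (ebase j 0).
Proof.
move=> Oz; rewrite mxE; congr (_ * _).
have H : \near z, energy_along z (ebase i 0) = pdy i (sqF F) z.
  by near=> z'; rewrite pdy_sqF//; near: z'; exact: near_slit.
rewrite /pdy -(near_eq_derive _ H).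
exact: (@derive_val _ _ _ _ _ _ _ (energy_along_vertical (ebase i 0) (ebase j) Oz)).
Unshelve. all: by end_near. Qed.

Lemma lower_fundamental z (v : 'I_n -> R) l : slit z ->
  lower (fundamental_tensor F z) v l = 2^-1 * hessian z (ebase l 0) v.
Proof.
move=> Oz; have Xz := Oz.1; have sa := a_sym Xz.
pose c2 := 2 * denergy_alpha z 1 0 * lower (a z.1) (z.2 0) l
  + denergy_beta z 1 0 * b z.1 0 l.
pose c3 := 2 * denergy_alpha z 0 1 * lower (a z.1) (z.2 0) l
  + denergy_beta z 0 1 * b z.1 0 l.
have E (w : 'I_n -> R) : hessian z (ebase l 0) w = 2 * energy_alpha z * lower (a z.1) w l
    + c2 * pairing (lower (a z.1) (z.2 0)) w + c3 * pairing (b z.1 0) w.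
  rewrite /hessian pairing_ebase [bilin _ _ (ebase l 0)]bilin_ebase//.
  rewrite [bilin _ (ebase l 0) _]bilinC// bilin_ebase// bilin_lowerl//.
  by rewrite /c2 /c3 /denergy_alpha /denergy_beta /dratio; ring.
rewrite E {1}/lower.
under eq_bigr => m _ do rewrite fundamental_tensorE// E !pairing_ebase
  -[lower (a z.1) (ebase m 0) l]/(pairing _ (ebase m 0)) pairing_ebase.
rewrite /lower /pairing !mulr_sumr -!big_split !mulr_sumr.
by apply: eq_bigr => m _ /=; ring.
Qed.

Lemma bilin_fundamental z (u v : 'I_n -> R) : slit z ->
  bilin (fundamental_tensor F z) u v = 2^-1 * hessian z u v.
Proof.
move=> Oz; have Xz := Oz.1; have sa := a_sym Xz.
rewrite bilin_lowerr /pairing.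
under eq_bigr => l _ do rewrite lower_fundamental//.
rewrite /hessian; set vy := bilin _ _ v; set vb := pairing _ v.
under eq_bigr => l _ do rewrite [bilin _ (ebase l 0) v]bilinC// !bilin_ebase// pairing_ebase.
rewrite [bilin _ u v]bilin_lowerr [bilin _ (z.2 0) u]bilin_lowerl//.
rewrite [pairing _ u]pairingC [pairing (b _ _) u]pairingC /pairing.
rewrite !mulr_sumr -!big_split mulr_sumr; apply: eq_bigr => l _ /=; ring.
Qed.

(** * Consequences of convexity *)

Hypothesis n_ge2 : (2 <= n)%N.
Hypothesis F_convex : forall z, slit z -> positive_definite (fundamental_tensor F z).

Lemma hessian_gt0 z (v : 'I_n -> R) : slit z -> (exists i, v i != 0) ->
  0 < hessian z v v.
Proof.
move=> Oz v0; have := positive_definite_bilin (F_convex Oz) v0.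
by rewrite bilin_fundamental// pmulr_rgt0 ?invr_gt0.
Qed.

Lemma exists_annihilated (c : 'I_n -> R) :
  exists2 w : 'rV[R]_n, w != 0 & pairing c (w 0) = 0.
Proof.
pose C : 'cV[R]_n := \col_i c i.
have : kermx C != 0.
  rewrite -mxrank_eq0 mxrank_ker subn_eq0 -ltnNge.
  exact: leq_ltn_trans (rank_leq_col C) n_ge2.
case/rowV0Pn => w /sub_kermxP wC w0; exists w => //.
have := congr1 (fun m : 'M[R]_(1, 1) => m 0 0) wC; rewrite !mxE => <-.
by apply: eq_bigr => i _; rewrite mxE mulrC.
Qed.

(** With [u] the multiple of the dual vector of [b] on which [b] takes the value
    [beta b z], and [w = y - u], the restriction of the energy to [u + h *: w] is
    strictly convex and even in [h], because [w] is annihilated by [b] and orthogonal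
    to [u]. Its derivative therefore increases from [0] at [h = 0]. The cases
    [beta b z = 0] and [w = 0] need separate arguments. *)
Lemma energy_alpha_gt0 z : slit z -> 0 < energy_alpha z.
Proof.
move=> Oz; have Xz := Oz.1; case: z Oz Xz => x y Oz /= Xx.
have sa := a_sym Xx.
have [b0|b0] := eqVneq (beta b (x, y)) 0.
  rewrite /energy_alpha [X in _ - X * _](_ : _ = 0); last by rewrite /pt/= b0 mul0r.
  by rewrite mul0r subr0 mulr_gt0// phi_pos.
(* The second derivative in a direction annihilated by [b] and orthogonal to [y]
   is [2 energy_alpha a(v, v)]. *)
have key v : v != 0 -> pairing (b x 0) (v 0) = 0 -> bilin (a x) (y 0) (v 0) = 0 ->
    0 < energy_alpha (x, y).
  move=> v0 bv yv; have vv := positive_definite_bilin (a_pos Xx) (rV_neq0 v0).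
  have := hessian_gt0 Oz (rV_neq0 v0).
  by rewrite /hessian /= bv yv !mulr0 !addr0 pmulr_lgt0// pmulr_rgt0.
pose B := bup a b x; pose t := pairing (b x 0) B.
have Bv (v : 'I_n -> R) : bilin (a x) B v = pairing (b x 0) v by exact: bilin_bup.
have t0 : 0 < t.
  rewrite /t -Bv; apply: positive_definite_bilin; first exact: a_pos.
  have [//|B0] := vector_neq0 B; case/eqP: b0.
  by rewrite -[LHS]/(pairing (b x 0) (y 0)) -Bv B0 bilinC// bilin0r.
pose c := beta b (x, y) / t; pose u : 'rV[R]_n := \row_i (c * B i + 0 * B i).
have u0E : u 0 = fun i => c * B i + 0 * B i by apply/funext => i; rewrite mxE.
have bu : pairing (b x 0) (u 0) = beta b (x, y).
  by rewrite u0E pairing_lin -/t /c; field; rewrite gt_eqF.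
have u_orth (v : 'I_n -> R) : pairing (b x 0) v = 0 -> bilin (a x) (u 0) v = 0.
  by move=> bv; rewrite bilinC// u0E bilin_linr bilinC// Bv bv !mulr0 addr0.
pose w := y - u.
have w0E : w 0 = fun i => 1 * y 0 i + -1 * u 0 i.
  by apply/funext => i; rewrite !mxE; ring.
have bw : pairing (b x 0) (w 0) = 0.
  rewrite w0E pairing_lin bu -[pairing _ (y 0)]/(beta b (x, y)); ring.
have [w_eq0|w_neq0] := eqVneq w 0.
  have [v v0 bv] := exists_annihilated (b x 0).
  apply: (key v) => //.
  by have -> : y = u by [apply/eqP; rewrite -subr_eq0 -/w w_eq0]; exact: u_orth.
have uhE h : (u + h *: w) 0 = fun i => 1 * u 0 i + h * w 0 i.
  by apply/funext => i; rewrite !mxE; ring.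
have Oh h : slit (x, u + h *: w).
  split => //=; apply: contra_neq b0 => uh0.
  have := congr1 (fun v : 'rV[R]_n => pairing (b x 0) (v 0)) uh0.
  rewrite /= uhE pairing_lin bw bu mulr0 addr0 mul1r => ->.
  by rewrite /pairing big1// => i _; rewrite mxE mulr0.
have ww : 0 < bilin (a x) (w 0) (w 0).
  exact: positive_definite_bilin (a_pos Xx) (rV_neq0 w_neq0).
pose E h := energy_along (x, u + h *: w) (w 0).
have EE h : E h = 2 * energy_alpha (x, u + h *: w) * (h * bilin (a x) (w 0) (w 0)).
  rewrite /E /energy_along /= bw mulr0 addr0 bilinC// uhE bilin_linr.
  by rewrite [bilin _ _ (u 0)]bilinC// u_orth// mulr0 add0r.
have dE (h : R) : is_derive h (1 : R) E (hessian (x, u + h *: w) (w 0) (w 0)).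
  have P (h' : R) : (x, u) + h' *: ((0, w) : 'rV[R]_n * 'rV[R]_n) = (x, u + h' *: w).
    have e : x + h' *: 0 = x by rewrite scaler0 addr0.
    exact: (congr1 (fun x' => (x', u + h' *: w)) e).
  have -> : E = fun h' => energy_along ((x, u) + h' *: ((0, w) : 'rV[R]_n * 'rV[R]_n)) (w 0).
    by apply/funext => h'; rewrite P.
  by apply: (is_derive_along (f := energy_along ^~ (w 0))); rewrite P;
    exact: energy_along_vertical.
have cE : {within `[0, 1], continuous E}.
  by apply: derivable_within_continuous => h _; exact: (@ex_derive _ _ _ _ _ _ _ (dE h)).
have [h _] := MVT ltr01 (fun h _ => dE h) cE.
rewrite !EE mul0r mulr0 subr0 scale1r mul1r subr0 mulr1 => H.
have : 0 < 2 * energy_alpha (x, u + w) * bilin (a x) (w 0) (w 0).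
  by rewrite H; apply: hessian_gt0 => //; exact: rV_neq0.
by rewrite /w addrC subrK pmulr_lgt0// pmulr_rgt0.
Qed.

Lemma phi_ratio_gt0 z : slit z ->
  0 < phi (pt z) - (pt z).2 * d2 phi (pt z).
Proof.
by move=> Oz; have := energy_alpha_gt0 Oz; rewrite pmulr_rgt0// phi_pos.
Qed.

Lemma pt2E z : slit z -> beta b z = (pt z).2 * alpha a z.
Proof. by move=> Oz; rewrite /pt/= divfK// alpha_neq0. Qed.

Lemma pt2_sqr_le z : slit z -> (pt z).2 ^+ 2 <= (pt z).1.
Proof.
move=> Oz; have [Xz _] := Oz.
have := pairing_sqr_le (b z.1 0) (z.2 0) (a_sym Xz) (a_pos Xz).
rewrite -[pairing _ (z.2 0)]/(beta b z) -/(alpha2 z) -alpha_sqr// pt2E//.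
rewrite exprMn ler_pM2r ?exprn_gt0 ?alpha_gt0//.
by rewrite /pt/= bsq_bup.
Qed.

(** If [s^2 < b^2], the fundamental tensor is evaluated on [w = B - la y], with [B] the
    vector dual to [b], which is [g]-orthogonal to [y]; the value is [phi (b^2 - s^2) Delta]. If [s^2 = b^2],
    then [Delta] is [phi - s phi_2]. *)
Lemma phiDelta_gt0 z : slit z -> 0 < phiDelta phi (pt z).
Proof.
move=> Oz; have [Xz _] := Oz; have sa := a_sym Xz.
have D0 := phi_ratio_gt0 Oz.
have [t_eq|t_neq] := eqVneq (pt z).1 ((pt z).2 ^+ 2).
  by rewrite /phiDelta t_eq subrr mul0r addr0.
have t_gt : 0 < (pt z).1 - (pt z).2 ^+ 2.
  by rewrite subr_gt0 lt_neqAle eq_sym t_neq pt2_sqr_le.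
pose B := bup a b z.1; pose t := (pt z).1.
have tE : pairing (b z.1 0) B = t by rewrite /t /pt/= bsq_bup.
have Bv (v : 'I_n -> R) : bilin (a z.1) B v = pairing (b z.1 0) v by exact: bilin_bup.
have yy : bilin (a z.1) (z.2 0) (z.2 0) = alpha a z ^+ 2 by rewrite alpha_sqr.
have yB : bilin (a z.1) (z.2 0) B = (pt z).2 * alpha a z.
  by rewrite bilinC// Bv -pt2E.
have bY : pairing (b z.1 0) (z.2 0) = (pt z).2 * alpha a z by rewrite -pt2E.
have al0 := alpha_neq0 Oz; have f0 : phi (pt z) != 0 by rewrite gt_eqF// phi_pos.
(* [la] is [g(b, y) / g(y, y)]; the energy is [g(y, y)] by homogeneity. *)
pose la := (2 * energy_alpha z * ((pt z).2 * alpha a z) + energy_beta z * t) /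
  (2 * (alpha a z ^+ 2 * phi (pt z) ^+ 2)).
pose w i := 1 * B i + - la * z.2 0 i.
have yw : bilin (a z.1) (z.2 0) w = (pt z).2 * alpha a z - la * alpha a z ^+ 2.
  by rewrite bilin_linr yy yB; ring.
have bw : pairing (b z.1 0) w = t - la * ((pt z).2 * alpha a z).
  by rewrite pairing_lin tE bY; ring.
have ww : bilin (a z.1) w w = t - la * ((pt z).2 * alpha a z)
    - la * ((pt z).2 * alpha a z - la * alpha a z ^+ 2).
  by rewrite {2}/w bilin_linr ![bilin _ w _]bilinC// Bv yw bw; ring.
have w0 : (exists i, w i != 0).
  have [//|w0] := vector_neq0 w.
  have e1 : t - la * ((pt z).2 * alpha a z) = 0 by rewrite -bw -Bv w0 bilin0r.
  have e2 : (pt z).2 * alpha a z - la * alpha a z ^+ 2 = 0 by rewrite -yw w0 bilin0r.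
  case/eqP: t_neq; rewrite -/t; apply: (mulIf (expf_neq0 2 al0)).
  have e3 : (pt z).2 = la * alpha a z.
    by apply: (mulIf al0); move/subr0_eq: e2 => ->; ring.
  by move/subr0_eq: e1 => ->; rewrite e3; ring.
have := hessian_gt0 Oz w0.
have -> : hessian z w w = 2 * phi (pt z) * (t - (pt z).2 ^+ 2) * phiDelta phi (pt z).
  rewrite /hessian yw bw ww /denergy_alpha /denergy_beta /dratio /phiDelta -/t.
  rewrite /la /energy_alpha /energy_beta.
  by field; rewrite al0 f0.
by rewrite pmulr_rgt0// mulr_gt0// mulr_gt0// phi_pos.
Qed.

(** * The spray equation *)

Lemma pdy_pdx_sqF l k z : slit z -> pdy l (pdx k (sqF F)) z =
  denergy_alpha z (lower (a z.1) (z.2 0) l) (b z.1 0 l) * bilin (dmetric k z.1) (z.2 0) (z.2 0)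
  + energy_alpha z * (2 * lower (dmetric k z.1) (z.2 0) l)
  + denergy_beta z (lower (a z.1) (z.2 0) l) (b z.1 0 l) * pairing (dform k z.1) (z.2 0)
  + energy_beta z * dform k z.1 l
  + denergy_bsq z (lower (a z.1) (z.2 0) l) (b z.1 0 l) * (2 * (r_l a b z.1 k + s_l a b z.1 k)).
Proof.
move=> Oz; have Xz := Oz.1.
have H : \forall z' \near z, energy_alpha (z' : 'rV[R]_n * 'rV[R]_n)
      * bilin (dmetric k z'.1) (z'.2 0) (z'.2 0)
     + energy_beta z' * pairing (dform k z'.1) (z'.2 0)
     + energy_bsq z' * (2 * (r_l a b z'.1 k + s_l a b z'.1 k)) = pdx k (sqF F) z'.
  by near=> z'; rewrite pdx_sqF//; near: z'; exact: near_slit.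
rewrite /pdy -(near_eq_derive _ H).
have D := is_derive_add (is_derive_add
  (is_derive_mul (energy_alpha_vertical (ebase l) Oz)
    (is_derive_bilin_vertical (A := dmetric k) (ebase l) (dmetric_sym k Xz)))
  (is_derive_mul (energy_beta_vertical (ebase l) Oz)
    (is_derive_pairing_vertical (dform k) z (ebase l))))
  (is_derive_mul (energy_bsq_vertical (ebase l) Oz)
    (is_derive_base_vertical (fun x => 2 * (r_l a b x k + s_l a b x k)) z (ebase l))).
rewrite (@derive_val _ _ _ _ _ _ _ D).
rewrite [bilin (a _) _ _]bilin_ebase ?a_sym//.
rewrite [bilin (dmetric _ _) _ (ebase l 0)]bilin_ebase ?dmetric_sym//.
by rewrite !pairing_ebase /=; ring.
Unshelve. all: by end_near. Qed.

(** The Christoffel symbols are absorbed by [spray_lower], leaving the symmetric part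
    [r_00] and the antisymmetric part of the covariant derivative of the form. *)
Lemma spray_rhsE z l : slit z -> spray_rhs F z l =
  denergy_alpha z (lower (a z.1) (z.2 0) l) (b z.1 0 l) * (4 * pairing (z.2 0) (spray_lower z))
  + denergy_beta z (lower (a z.1) (z.2 0) l) (b z.1 0 l)
    * (r_00 a b z + 2 * pairing (bup a b z.1) (spray_lower z))
  + denergy_bsq z (lower (a z.1) (z.2 0) l) (b z.1 0 l) * (2 * (r_0 a b z + s_0 a b z))
  + energy_alpha z * (4 * spray_lower z l)
  + energy_beta z * (2 * pairing (s_ll a b z.1 l) (z.2 0))
  - energy_bsq z * (2 * (r_l a b z.1 l + s_l a b z.1 l)).
Proof.
move=> Oz; have Xz := Oz.1; rewrite /spray_rhs pdx_sqF//.
under eq_bigr => k _ do rewrite pdy_pdx_sqF//.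
set dea := denergy_alpha z _ _; set deb := denergy_beta z _ _.
set det := denergy_bsq z _ _.
rewrite -pairing_spray_lower -form_derivative_r00// -form_curl//.
have -> : r_0 a b z + s_0 a b z =
    \sum_(k < n) z.2 0 k * (r_l a b z.1 k + s_l a b z.1 k).
  by rewrite -big_split; apply: eq_bigr => k _ /=; ring.
have -> : 4 * spray_lower z l =
    2 * (\sum_(k < n) z.2 0 k * lower (dmetric k z.1) (z.2 0) l)
    - bilin (dmetric l z.1) (z.2 0) (z.2 0) by rewrite /spray_lower; field.
(* Stated for arbitrary functions, so that the sums inside [bilin], [r_l] and [s_l]
   are not split. *)
have sum_lin (f1 f2 f3 f4 f5 : 'I_n -> R) (k1 k2 k3 k4 k5 : R) :
    \sum_(k < n) (k1 * f1 k + k2 * (2 * f2 k) + k3 * f3 k + k4 * f4 k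
      + k5 * (2 * f5 k)) * z.2 0 k =
    k1 * (\sum_(k < n) z.2 0 k * f1 k) + k2 * (2 * (\sum_(k < n) z.2 0 k * f2 k))
    + k3 * (\sum_(k < n) z.2 0 k * f3 k) + k4 * (\sum_(k < n) z.2 0 k * f4 k)
    + k5 * (2 * (\sum_(k < n) z.2 0 k * f5 k)).
  rewrite !mulr_sumr -!big_split; apply: eq_bigr => k _ /=; ring.
rewrite (sum_lin (fun k => bilin (dmetric k z.1) (z.2 0) (z.2 0))
  (fun k => lower (dmetric k z.1) (z.2 0) l)
  (fun k => pairing (dform k z.1) (z.2 0)) (fun k => dform k z.1 l)
  (fun k => r_l a b z.1 k + s_l a b z.1 k)).
by ring.
Qed.

Lemma s_ll_antisym x i j : s_ll a b x i j = - s_ll a b x j i.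
Proof. by rewrite /s_ll; ring. Qed.

Lemma pairing_antisym x (v : 'I_n -> R) :
  pairing v (fun j => pairing (s_ll a b x j) v) = 0.
Proof.
have H : pairing v (fun j => pairing (s_ll a b x j) v) =
    - pairing v (fun j => pairing (s_ll a b x j) v).
  rewrite {1}/pairing; under eq_bigr do rewrite mulr_sumr.
  rewrite exchange_big /pairing -sumrN; apply: eq_bigr => i _.
  rewrite mulr_sumr -sumrN; apply: eq_bigr => j _.
  by rewrite s_ll_antisym; ring.
by lra.
Qed.

Lemma pairing_raise x (u c : 'I_n -> R) : X x ->
  pairing (lower (a x) u) (lower (ainv a x) c) = pairing u c.
Proof.
by move=> Xx; rewrite -bilin_lowerl ?a_sym// bilin_lowerr lower_invmx ?a_unit.
Qed.

Lemma s_lE x i : s_l a b x i = - pairing (s_ll a b x i) (bup a b x).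
Proof.
rewrite /s_l /pairing -sumrN; apply: eq_bigr => j _; rewrite s_ll_antisym; ring.
Qed.

Lemma s_u0E z : s_u0 a b z =
  lower (ainv a z.1) (fun j => pairing (s_ll a b z.1 j) (z.2 0)).
Proof.
apply/funext => i; apply: eq_bigr => j _.
by rewrite mulr_sumr; apply: eq_bigr => k _; rewrite mulrA.
Qed.

Lemma s_0E z :
  pairing (bup a b z.1) (fun j => pairing (s_ll a b z.1 j) (z.2 0)) = s_0 a b z.
Proof.
rewrite /pairing; under eq_bigr do rewrite mulr_sumr.
rewrite exchange_big; apply: eq_bigr => i _; rewrite mulr_suml.
by apply: eq_bigr => j _; ring.
Qed.

(** The shape of the candidate solution; its coefficients enter the computation only
    at the very end. *)
Definition spray_comb z (p q s t : R) (i : 'I_n) : R :=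
  spray (alpha a) z i + p * s_u0 a b z i + q * z.2 0 i + s * bup a b z.1 i
  - t * (r_u a b z.1 i + s_u a b z.1 i).

Lemma pairing_spray_comb z (c : 'I_n -> R) (p q s t : R) :
  pairing c (spray_comb z p q s t) =
  pairing c (spray (alpha a) z) + p * pairing c (s_u0 a b z)
  + q * pairing c (z.2 0) + s * pairing c (bup a b z.1)
  - t * (pairing c (r_u a b z.1) + pairing c (s_u a b z.1)).
Proof.
rewrite /pairing mulrDr !mulr_sumr -!big_split -sumrB.
by apply: eq_bigr => i _ /=; rewrite /spray_comb; ring.
Qed.

Lemma lower_spray_comb z l (p q s t : R) : X z.1 ->
  lower (a z.1) (spray_comb z p q s t) l =
  spray_lower z l + p * pairing (s_ll a b z.1 l) (z.2 0)
  + q * lower (a z.1) (z.2 0) l + s * b z.1 0 l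
  - t * (r_l a b z.1 l + s_l a b z.1 l).
Proof.
move=> Xz; rewrite -[LHS]/(pairing (a z.1 l) _) pairing_spray_comb.
have E (w : 'I_n -> R) : pairing (a z.1 l) w = lower (a z.1) w l by [].
rewrite !E lower_spray_alpha// lower_bup// s_u0E.
by rewrite !lower_invmx ?a_unit.
Qed.

Lemma pairing_fiber_spray_comb z p q s t : X z.1 ->
  bilin (a z.1) (z.2 0) (spray_comb z p q s t) =
  pairing (z.2 0) (spray_lower z) + q * alpha a z ^+ 2
  + s * beta b z - t * (r_0 a b z + s_0 a b z).
Proof.
move=> Xz; rewrite bilin_lowerl ?a_sym// pairing_spray_comb s_u0E.
rewrite !pairing_raise// pairing_antisym mulr0 addr0.
rewrite -!(@bilin_lowerl _ _ (a z.1)) ?a_sym// bilin_lowerr lower_spray_alpha//.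
rewrite -/(alpha2 z) -alpha_sqr// (pairingC _ (b z.1 0)).
by rewrite (pairingC _ (r_l a b z.1)) (pairingC _ (s_l a b z.1)).
Qed.

Lemma pairing_form_spray_comb z p q s t : X z.1 ->
  pairing (b z.1 0) (spray_comb z p q s t) =
  pairing (bup a b z.1) (spray_lower z) + p * s_0 a b z + q * beta b z
  + s * bsq a b z.1 - t * r_bb a b z.1.
Proof.
move=> Xz; rewrite pairing_spray_comb s_u0E -bsq_bup -[in LHS]lower_bup//.
rewrite !pairing_raise// s_0E.
rewrite -[pairing _ (spray _ _)]bilin_lowerl ?a_sym// bilin_lowerr lower_spray_alpha//.
have -> : pairing (bup a b z.1) (s_l a b z.1) = 0.
  have -> : s_l a b z.1 = fun i => 0 * 0 + -1 * pairing (s_ll a b z.1 i) (bup a b z.1).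
    by apply/funext => i; rewrite s_lE; ring.
  by rewrite (pairing_lin _ 0 (-1) (fun=> 0)) pairing_antisym; ring.
by rewrite addr0 lower_bup.
Qed.

Lemma spray_alphabeta z i : slit z ->
  let al := alpha a z in
  let p := pt z in
  let Q := phiQ phi p in
  let R' := phiR phi p in
  let r0 := r_0 a b z in
  let s0 := s_0 a b z in
  let c := - (2 * al * Q * s0) + r_00 a b z + 2 * al ^+ 2 * R' * r_bb a b z.1 in
  spray F z i = spray_comb z (al * Q)
    ((phiTheta phi p * c + al * phiOmega phi p * (r0 + s0)) / al)
    (phiPsi phi p * c + al * phiPi phi p * (r0 + s0)) (al ^+ 2 * R') i.
Proof.
move=> Oz al p Q R' r0 s0 c; have Xz := Oz.1.
have uF : fundamental_tensor F z \in unitmx.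
  exact/positive_definite_unitmx/F_convex.
set q := (_ + _) / al; set u := (_ + _); set V := spray_comb _ _ _ _ _.
suff H : (fun l => 4^-1 * spray_rhs F z l) = lower (fundamental_tensor F z) V.
  by rewrite sprayE H invmx_lower.
apply/funext => l; rewrite lower_fundamental// spray_rhsE// /hessian /=.
rewrite pairing_ebase bilin_ebase ?a_sym//.
rewrite [bilin _ (ebase l 0) _]bilinC ?a_sym// bilin_ebase ?a_sym//.
rewrite /V lower_spray_comb// pairing_fiber_spray_comb// pairing_form_spray_comb//.
have al0 := alpha_neq0 Oz; have f0 : phi (pt z) != 0 by rewrite gt_eqF// phi_pos.
have D0 : phi (pt z) - (pt z).2 * d2 phi (pt z) != 0 by rewrite gt_eqF// phi_ratio_gt0.
have E0 : phiDelta phi (pt z) != 0 by rewrite gt_eqF// phiDelta_gt0.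
rewrite pt2E//.
exact: contracted_spray_equation.
Qed.

End AlphaBetaMetric.
End RiemannianData.

(** * The theorem *)

(** By the Cauchy-Schwarz inequality [|s| <= b], and [b < bo] by assumption. *)
Lemma pt_phi_domain (R : realType) (n : nat) (X : set 'rV[R]_n)
    (a : 'rV[R]_n -> 'M[R]_n) (b : 'rV[R]_n -> 'rV[R]_n) (bo : \bar R) :
  (forall x, X x -> (a x)^T = a x) ->
  (forall x, X x -> positive_definite (a x)) ->
  (forall x, X x -> ((Num.sqrt (bsq a b x))%:E < bo)%E) ->
  forall z, slit X z -> phi_domain bo (pt a b z).
Proof.
move=> sa pa b_lt z Oz; have s2 := pt2_sqr_le b sa pa Oz.
have t_ge0 := le_trans (sqr_ge0 _) s2.
exists (Num.sqrt (bsq a b z.1)); split.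
- by rewrite sqr_sqrtr.
- by rewrite -sqrtr_sqr ler_wsqrtr.
- by apply: b_lt; case: Oz.
Qed.

Theorem proposition3p4 (R : realType) (n : nat) (hn : (2 <= n)%N)
  (M : manifold R n)
  (a : chart R n M -> 'rV[R]_n -> 'M[R]_n)
  (b : chart R n M -> 'rV[R]_n -> 'rV[R]_n)
  (bo : \bar R) (phi : R * R -> R)
  (F : chart R n M -> 'rV[R]_n * 'rV[R]_n -> R)
  (ha : riemannian_metric a)
  (hb : one_form b)
  (hbo : (0 < bo)%E)
  (hbbo : forall c x, atlas c -> chart_img c x ->
     ((Num.sqrt (bsq (a c) (b c) x))%:E < bo)%E)
  (hphi_smooth : exists U : set (R * R),
     [/\ open U, phi_domain bo `<=` U & smooth_on U phi])
  (hphi_pos : forall p, phi_domain bo p -> 0 < phi p)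
  (hF : finsler_metric F)
  (hFphi : forall c x (y : 'rV[R]_n), atlas c -> chart_img c x -> y != 0 ->
     F c (x, y) = alpha (a c) (x, y) *
       phi (bsq (a c) (b c) x, beta (b c) (x, y) / alpha (a c) (x, y))) :
  forall c, atlas c ->
  forall x y : 'rV[R]_n, chart_img c x -> y != 0 ->
  forall i : 'I_n,
  let z := (x, y) in
  let A := a c in
  let B := b c in
  let al := alpha A z in
  let p := (bsq A B x, beta B z / al) in
  let Q := phiQ phi p in
  let R' := phiR phi p in
  let Theta := phiTheta phi p in
  let Psi := phiPsi phi p in
  let Pi := phiPi phi p in
  let Omega := phiOmega phi p in
  let r0 := r_0 A B z in
  let s0 := s_0 A B z in
  let r00 := r_00 A B z in
  let r := r_bb A B x in
  spray (F c) z i =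
    spray (alpha A) z i + al * Q * s_u0 A B z i
    + (Theta * (- (2 * al * Q * s0) + r00 + 2 * al ^+ 2 * R' * r)
       + al * Omega * (r0 + s0)) * (y 0 i / al)
    + (Psi * (- (2 * al * Q * s0) + r00 + 2 * al ^+ 2 * R' * r)
       + al * Pi * (r0 + s0)) * bup A B x i
    - al ^+ 2 * R' * (r_u A B x i + s_u A B x i).
Proof.
move=> c Ac x y Xx y0 i z A B al p Q R' Theta Psi Pi Omega r0 s0 r00 r.
have [a_local _] := ha; have [a_smooth a_sp] := a_local c Ac.
have b_smooth := hb.1 c Ac.
have a_sym x' (Xx' : chart_img c x') := (a_sp x' Xx').1.
have a_pos x' (Xx' : chart_img c x') := (a_sp x' Xx').2.
have da x' : chart_img c x' ->
    forall v j k, derivable (fun w => a c w j k) x' v.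
  move=> Xx' v; apply/derivable_mxP/diff_derivable.
  exact: (a_smooth 1%N).1.
have db x' : chart_img c x' -> forall v j, derivable (fun w => b c w 0 j) x' v.
  move=> Xx' v j; have /derivable_mxP dbc : derivable (b c) x' v.
    by apply: diff_derivable; exact: (b_smooth 1%N).1.
  exact: dbc.
have [U [_ domU phi_smooth]] := hphi_smooth.
have dphi q : U q ->
    [/\ differentiable phi q, differentiable (d1 phi) q & differentiable (d2 phi) q].
  move=> Uq; have [H1 H2] := phi_smooth 2%N.
  by split; [exact: H1 | exact: (H2 _).1 | exact: (H2 _).1].
have dom z' : slit (chart_img c) z' -> phi_domain bo (pt (a c) (b c) z').
  by apply: pt_phi_domain => // x' Xx'; exact: hbbo.
have [_ /(_ c Ac) [_ _ _ _ [_ F_convex]]] := hF.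
have Oz : slit (chart_img c) z by split.
rewrite (@spray_alphabeta _ _ (chart_img c) (a c) (b c) (@chart_img_open _ _ _ c)
  a_sym a_pos da db U phi dphi (fun z' Oz' => domU _ (dom z' Oz'))
  (fun z' Oz' => hphi_pos _ (dom z' Oz')) (F c) _ hn _ z i Oz).
- by rewrite /spray_comb [_ * (y 0 i / al)]mulrA [_ / _ * _]mulrAC.
- by move=> [x' y'] [Xx' y0']; exact: hFphi.
- by move=> [x' y'] [Xx' y0']; exact: F_convex.
Qed.
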